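(* Let $G$ be a graph on $[n]$ and let $\psi$ be a $d$-compatible map. Then $$\operatorname{depth} S/J_G\geq \psi(G).$$
   Context: All graphs are finite and simple. Here $[n]=\{1,\ldots,n\}$, $\mathbb{K}$ is a field and $S=\mathbb{K}[x_1,\ldots,x_n,y_1,\ldots,y_n]$. The binomial edge ideal of a graph $G$ on $[n]$ is the ideal $J_G\subseteq S$ generated by the binomials $f_{ij}=x_iy_j-x_jy_i$ with $\{i,j\}\in E(G)$, $1\le i<j\le n$. The depth is taken with respect to the maximal homogeneous ideal $\mathfrak{m}=(x_1,\ldots,x_n,y_1,\ldots,y_n)$: $\operatorname{depth} S/J_G=\min\{i: H^i_{\mathfrak m}(S/J_G)\neq 0\}$. A vertex $v$ of $G$ is free if the induced subgraph of $G$ on its neighbourhood $N_G(v)$ is complete, and non-free otherwise. $G-v$ is the induced subgraph on $V(G)\setminus\{v\}$. $G_v$ is the graph with vertex set $V(G)$ and edge set $E(G)\cup\{\{u,w\}:\{u,w\}\subseteq N_G(v)\}$ ($u\ne w$). $K_t$ is the complete graph on $t$ vertices. Let $\mathcal{G}$ be the set of all graphs and $\mathbb{N}_0$ the set of non-negative integers. A map $\psi:\mathcal{G}\to\mathbb{N}_0$ is called $d$-compatible if: (a) if $G=\dot\cup_{i=1}^t K_{n_i}$ is a disjoint union of complete graphs, where $n_i\ge1$ for every $1\le i\le t$, then $\psi(G)\le t+\sum_{i=1}^t n_i$; (b) if $G$ is not a disjoint union of complete graphs, then there exists a non-free vertex $v\in V(G)$ such that (1) $\psi(G-v)\ge\psi(G)$,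 and (2) $\psi(G_v)\ge\psi(G)$, and (3) $\psi(G_v-v)\ge\psi(G)-1$. *)

(* Defs.v *)
From HB Require Import structures.
From mathcomp Require Import all_boot all_algebra.
From mathcomp Require Import generic_quotient ring_quotient.
From mathcomp Require Import boolp.
From mathcomp Require Import mpoly.

Set Implicit Arguments.
Unset Strict Implicit.
Unset Printing Implicit Defensive.

Import GRing.Theory.
Local Open Scope ring_scope.

Section Ideals.
Variable R : comNzRingType.

Definition ideal_span (A : R -> Prop) : pred R := fun p =>
  `[< exists (m : nat) (c g : 'I_m -> R),
        (forall i, A (g i)) /\ p = \sum_(i < m) c i * g i >].

Lemma ideal_span_submod_closed (A : R -> Prop) :
  @submod_closed R R^o (ideal_span A).
Proof.
split.
  apply/asboolP; exists 0%N, (fun=> 0), (fun=> 0).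
  by split=> [[]|]; rewrite ?big_ord0.
move=> a x y /asboolP[m [c [g [Ag ->]]]] /asboolP[n [d [h [Ah ->]]]].
apply/asboolP; exists (m + n)%N.
exists (fun i => match split i with inl j => a * c j | inr j => d j end).
exists (fun i => match split i with inl j => g j | inr j => h j end).
split=> [i|]; first by case: split.
rewrite big_split_ord /=; congr (_ + _).
  rewrite [LHS]mulr_sumr; apply: eq_bigr => i _.
  by rewrite -[lshift n i]/(unsplit (inl i)) unsplitK mulrA.
by apply: eq_bigr => i _; rewrite -[rshift m i]/(unsplit (inr i)) unsplitK.
Qed.

Definition ideal_pow (I : pred R) (k : nat) : pred R :=
  ideal_span (fun p => exists g : 'I_k -> R,
                 (forall i, g i \in I) /\ p = \prod_(i < k) g i).

End Ideals.

Section QuotientModule.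
Variables (R : pzRingType) (M : lmodType R).
Variables (N : {pred M}) (N_submod : submod_closed N).
Local Open Scope quotient_scope.

(* A copy of N, so that the instances below can depend on [N_submod]. *)
Definition submod_pred of submod_closed N : {pred M} := N.
Local Notation NN := (submod_pred N_submod).

Fact submod_pred_zmod_closed : zmod_closed NN.
Proof. exact: GRing.submod_closedB N_submod. Qed.

HB.instance Definition _ :=
  GRing.isZmodClosed.Build M NN submod_pred_zmod_closed.

Definition submod_zmod : zmodClosed M :=
  Algebra.ZmodClosed.clone M NN _.

Local Notation Q := (Quotient.quot submod_zmod).

Definition quot_scale (a : R) (x : Q) : Q := \pi_Q (a *: repr x).

Lemma quot_pi_eq (x y : M) : (\pi_Q x == \pi_Q y) = (x - y \in N).
Proof. by rewrite -Quotient.idealrBE. Qed.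

Lemma quot_piD (x y : M) : \pi_Q (x + y) = \pi_Q x + \pi_Q y.
Proof. exact: Quotient.pi_add. Qed.

Lemma quot_scale_pi a (x : M) : quot_scale a (\pi_Q x) = \pi_Q (a *: x).
Proof.
have [_ N_lin] := N_submod; have N0 := GRing.submod_closedB N_submod.
apply/eqP; rewrite quot_pi_eq -scalerBr -[_ *: _]addr0 N_lin ?N0.1 //.
by rewrite -quot_pi_eq reprK.
Qed.

Lemma quot_pi_surj (x : Q) : exists y : M, x = \pi_Q y.
Proof. by exists (repr x); rewrite reprK. Qed.

Fact quot_scaleA a b x : quot_scale a (quot_scale b x) = quot_scale (a * b) x.
Proof. by have [y ->] := quot_pi_surj x; rewrite !quot_scale_pi scalerA. Qed.

Fact quot_scale1 : left_id 1 quot_scale.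
Proof.
by move=> x; have [y ->] := quot_pi_surj x; rewrite quot_scale_pi scale1r.
Qed.

Fact quot_scaleDr : right_distributive quot_scale +%R.
Proof.
move=> a x y; have [u ->] := quot_pi_surj x; have [v ->] := quot_pi_surj y.
by rewrite -quot_piD !quot_scale_pi scalerDr quot_piD.
Qed.

Fact quot_scaleDl x : {morph quot_scale^~ x : a b / a + b}.
Proof.
move=> a b; have [y ->] := quot_pi_surj x.
by rewrite !quot_scale_pi scalerDl quot_piD.
Qed.

HB.instance Definition _ := GRing.Zmodule_isLmodule.Build R Q
  quot_scaleA quot_scale1 quot_scaleDr quot_scaleDl.

Definition quot_module : lmodType R := Q.

End QuotientModule.

Section LocalCohomology.
Variable R : comNzRingType.

Definition injective_module (E : lmodType R) : Prop :=
  forall (A B : lmodType R) (f : {linear A -> B}) (g : {linear A -> E}),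
    injective f -> exists h : {linear B -> E}, forall a, h (f a) = g a.

Record injective_resolution (M : lmodType R) := InjectiveResolution {
  ires_obj : nat -> lmodType R;
  ires_aug : {linear M -> ires_obj 0};
  ires_diff : forall i, {linear ires_obj i -> ires_obj i.+1};
  ires_injective : forall i, injective_module (ires_obj i);
  ires_aug_inj : injective ires_aug;
  ires_exact0 : forall z, ires_diff 0 z = 0 <-> exists x, z = ires_aug x;
  ires_exactS : forall i z,
    ires_diff i.+1 z = 0 <-> exists w, z = ires_diff i w
}.

Variable I : pred R.

(* The functor Gamma_I, as a predicate on the elements of E. *)
Definition torsion (E : lmodType R) (z : E) : Prop :=
  exists k : nat, forall a, a \in ideal_pow I k -> a *: z = 0.

Definition torsion_cocycle (M : lmodType R) (E : injective_resolution M)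
    (i : nat) (z : ires_obj E i) : Prop :=
  torsion z /\ ires_diff E i z = 0.

Definition torsion_coboundary (M : lmodType R) (E : injective_resolution M)
    (i : nat) : ires_obj E i -> Prop :=
  match i with
  | 0 => fun z => z = 0
  | j.+1 => fun z => exists w, torsion w /\ z = ires_diff E j w
  end.

(* H^i_I(M) is the i-th right derived functor of Gamma_I at M, i.e. the i-th
   cohomology of Gamma_I applied to an injective resolution of M; up to
   isomorphism it does not depend on the resolution. *)
Definition local_cohomology_neq0 (M : lmodType R) (i : nat) : Prop :=
  exists (E : injective_resolution M) (z : ires_obj E i),
    torsion_cocycle z /\ ~ torsion_coboundary z.

Definition is_depth (M : lmodType R) (d : nat) : Prop :=
  local_cohomology_neq0 M d /\
  forall i, local_cohomology_neq0 M i -> (d <= i)%N.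

End LocalCohomology.

Record sgraph (V : finType) := SGraph {
  edge :> rel V;
  edge_sym : ssrbool.symmetric edge;
  edge_irr : irreflexive edge
}.

Section GraphOperations.
Variables (V : finType) (G : sgraph V).

Definition free_vertex (v : V) : Prop :=
  forall u w, G v u -> G v w -> u != w -> G u w.

Lemma del_vertex_sym (v : V) :
  ssrbool.symmetric (fun a b : {x : V | x != v} => G (val a) (val b)).
Proof. by move=> a b; exact: edge_sym. Qed.

Lemma del_vertex_irr (v : V) :
  irreflexive (fun a b : {x : V | x != v} => G (val a) (val b)).
Proof. by move=> a; exact: edge_irr. Qed.

Definition del_vertex (v : V) : sgraph {x : V | x != v} :=
  SGraph (@del_vertex_sym v) (@del_vertex_irr v).

Definition complete_nbhd_rel (v : V) : rel V := fun u w =>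
  G u w || [&& u != w, G v u & G v w].

Lemma complete_nbhd_sym v : ssrbool.symmetric (complete_nbhd_rel v).
Proof.
move=> u w; rewrite /complete_nbhd_rel edge_sym eq_sym.
by congr (_ || (_ && _)); rewrite andbC.
Qed.

Lemma complete_nbhd_irr v : irreflexive (complete_nbhd_rel v).
Proof. by move=> u; rewrite /complete_nbhd_rel edge_irr eqxx. Qed.

(* The graph G_v. *)
Definition complete_nbhd (v : V) : sgraph V :=
  SGraph (complete_nbhd_sym v) (complete_nbhd_irr v).

(* G is the disjoint union of the complete graphs on the blocks of P; the
   blocks of a partition are nonempty. *)
Definition disjoint_union_complete (P : {set {set V}}) : Prop :=
  partition P [set: V] /\
  forall u w, G u w <-> u != w /\ exists2 B, B \in P & (u \in B) && (w \in B).

End GraphOperations.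

Definition d_compatible (psi : forall V : finType, sgraph V -> nat) : Prop :=
  (forall (V : finType) (G : sgraph V) (P : {set {set V}}),
     disjoint_union_complete G P ->
     (psi V G <= #|P| + \sum_(B in P) #|B|)%N) /\
  (forall (V : finType) (G : sgraph V),
     ~ (exists P : {set {set V}}, disjoint_union_complete G P) ->
     exists v : V,
       [/\ ~ free_vertex G v,
           (psi _ G <= psi _ (del_vertex G v))%N,
           (psi _ G <= psi _ (complete_nbhd G v))%N &
           (psi _ G - 1 <= psi _ (del_vertex (complete_nbhd G v) v))%N]).

Section BinomialEdgeIdeal.
Variables (K : fieldType) (n : nat).

(* The variables x_i and y_i are the first n and the last n variables. *)
Local Notation S := {mpoly K[n + n]}.

Definition xvar (i : 'I_n) : S := 'X_(lshift n i).
Definition yvar (i : 'I_n) : S := 'X_(rshift n i).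

Definition edge_binomial (i j : 'I_n) : S :=
  xvar i * yvar j - xvar j * yvar i.

Definition is_edge_binomial (G : sgraph 'I_n) (p : S) : Prop :=
  exists i j : 'I_n, [/\ (i < j)%N, G i j & p = edge_binomial i j].

Definition binomial_edge_ideal (G : sgraph 'I_n) : pred S :=
  ideal_span (is_edge_binomial G).

Definition max_homogeneous_ideal : pred S :=
  ideal_span (fun p : S => exists i : 'I_(n + n), p = 'X_i).

Definition binomial_edge_quotient (G : sgraph 'I_n) : lmodType S :=
  @quot_module S S^o (binomial_edge_ideal G)
    (ideal_span_submod_closed (is_edge_binomial G)).

End BinomialEdgeIdeal.

(* Main.v *)
Require Import Defs.
From HB Require Import structures.
From mathcomp Require Import all_boot all_algebra.
From mathcomp Require Import generic_quotient ring_quotient.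
From mathcomp Require Import boolp.
From mathcomp Require Import mpoly.
From mathcomp Require Import ring.

(** The bound follows from a recursion on graphs whose steps are short exact
    sequences, once depth is expressed by an invariant for which the depth lemma
    is elementary.

    Say that a module M over S = K[X_1, ..., X_N] has depth at least k if, for
    every r, the Koszul cohomology of M for the sequence X_1^r, ..., X_N^r
    vanishes in degrees below k ([depth_ge]). Koszul complexes are functorial in
    M, so a short exact sequence of modules gives a long exact sequence without
    any choice of resolutions. This yields the depth lemma for
    0 -> S/(A cap B) -> S/A x S/B -> S/(A + B) -> 0 ([depth_ge_inter]) and the
    gain of one for a variable that is regular on S/A ([depth_ge_regular]).

    This invariant bounds local cohomology from any injective resolution E of M
    ([depth_ge_local_cohomology]). Indeed X_1^r, ..., X_N^r is regular on S and
    each E^i is injective, so each X_j^r is surjective on the elements of E^i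
    annihilated by the preceding powers. Therefore the Koszul complex of E is
    quasi-isomorphic to the subcomplex of elements annihilated by all X_j^r, and
    every torsion element lies in this subcomplex for some r.

    For the recursion at a vertex v, J_G is the intersection of J_(G_v) and
    (x_v, y_v) + J_(G-v), and the sum of these two ideals is
    (x_v, y_v) + J_(G_v - v). The intersection is computed by the substitution
    x_v = y_v = 0 ([graph_ideal_inter]): x_v and y_v multiply the binomials
    added in G_v into J_G by the Plücker relations. If v is not free, all three
    graphs have fewer pairs of non-adjacent vertices than G, counting the pairs
    (u, u).

    The recursion ends at disjoint unions of complete graphs, where the depth is
    at least the number of vertices plus the number of components
    ([clique_depth]). The ideal is then the kernel of a monomial map, so it is
    prime ([toric_regular], [clique_connected]) and every x_v is regular. Modulo
    x_v, unless v is isolated, the ideal is an intersection of two ideals of the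
    same kind ([clique_intersection]), and the depth lemma applies again. *)

Set Implicit Arguments.
Unset Strict Implicit.
Unset Printing Implicit Defensive.

Import GRing.Theory.

(** * Linear maps given as functions *)

Section LinearFunctions.
Local Open Scope ring_scope.
Variables (R : comNzRingType) (U V : lmodType R) (f : U -> V).
Hypothesis f_lin : linear f.

(** Maps defined by cases on the degree are plain functions with a proof of
    linearity; the following lemmas serve them in place of those for bundled
    linear maps. *)
Lemma lin0 : f 0 = 0.
Proof. by have := f_lin (-1) 0 0; rewrite scaleN1r addNr scaleN1r addNr. Qed.

Lemma linZ a u : f (a *: u) = a *: f u.
Proof. by have := f_lin a u 0; rewrite lin0 !addr0. Qed.

Lemma linD u v : f (u + v) = f u + f v.
Proof. by have := f_lin 1 u v; rewrite !scale1r. Qed.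

Lemma linB u v : f (u - v) = f u - f v.
Proof. by rewrite linD -scaleN1r linZ scaleN1r. Qed.

Lemma linN u : f (- u) = - f u.
Proof. by rewrite -sub0r linB lin0 sub0r. Qed.

Definition to_linear : {linear U -> V} :=
  HB.pack f (GRing.isLinear.Build R U V _ f f_lin).

End LinearFunctions.

(** * Cochain complexes *)

Section Complexes.
Local Open Scope ring_scope.
Variable R : comNzRingType.

(** The predicate [cochain] cuts out the actual cochains inside each [obj i]:
    subcomplexes such as annihilators, and complexes that vanish in most
    degrees, then need no subtype of the ambient modules. *)
Record complex := Complex {
  obj : nat -> lmodType R;
  dif : forall i, obj i -> obj i.+1;
  cochain : forall i, obj i -> Prop;
  dif_lin : forall i, linear (@dif i);
  dif_dif : forall i (u : obj i), dif (dif u) = 0;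
  cochain0 : forall i, @cochain i 0;
  cochain_lin : forall i a (u v : obj i),
    cochain u -> cochain v -> cochain (a *: u + v);
  cochain_dif : forall i (u : obj i), cochain u -> cochain (dif u)
}.

Section Basics.
Variable C : complex.

Lemma cochainZ i a (u : obj C i) : cochain u -> cochain (a *: u).
Proof.
by move=> Cu; rewrite -[_ *: _]addr0; apply: cochain_lin; last exact: cochain0.
Qed.

Lemma cochainD i (u v : obj C i) : cochain u -> cochain v -> cochain (u + v).
Proof. by move=> Cu Cv; rewrite -[u]scale1r; apply: cochain_lin. Qed.

Lemma cochainB i (u v : obj C i) : cochain u -> cochain v -> cochain (u - v).
Proof. by move=> Cu Cv; rewrite addrC -scaleN1r; apply: cochain_lin. Qed.

Lemma cochainN i (u : obj C i) : cochain u -> cochain (- u).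
Proof. by rewrite -scaleN1r; apply: cochainZ. Qed.

Definition cocycle i (z : obj C i) : Prop := cochain z /\ dif z = 0.

Definition coboundary i : obj C i -> Prop :=
  match i with
  | 0 => fun z => z = 0
  | j.+1 => fun z => exists w : obj C j, cochain w /\ z = dif w
  end.

Definition acyclic i : Prop := forall z : obj C i, cocycle z -> coboundary z.

Lemma coboundary0 i : @coboundary i 0.
Proof.
case: i => //= i; exists 0; rewrite (lin0 (@dif_lin C i)).
by split=> //; apply: cochain0.
Qed.

Lemma coboundary_lin i a (u v : obj C i) :
  coboundary u -> coboundary v -> coboundary (a *: u + v).
Proof.
case: i u v => [|i] u v /=; first by move=> -> ->; rewrite scaler0 addr0.
move=> [u' [Cu ->]] [v' [Cv ->]]; exists (a *: u' + v').
by rewrite dif_lin; split=> //; apply: cochain_lin.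
Qed.

Lemma coboundaryZ i a (u : obj C i) : coboundary u -> coboundary (a *: u).
Proof.
move=> bu; rewrite -[_ *: _]addr0.
by apply: coboundary_lin; last exact: coboundary0.
Qed.

Lemma coboundaryD i (u v : obj C i) :
  coboundary u -> coboundary v -> coboundary (u + v).
Proof. by move=> bu bv; rewrite -[u]scale1r; apply: coboundary_lin. Qed.

Lemma cocycleZ i a (u : obj C i) : cocycle u -> cocycle (a *: u).
Proof.
case=> Cu du; split; first exact: cochainZ.
by rewrite (linZ (@dif_lin C i)) du scaler0.
Qed.

End Basics.

Record chain_map (C D : complex) (f : forall i, obj C i -> obj D i) : Prop :=
  ChainMap {
    cm_lin : forall i, linear (f i);
    cm_cochain : forall i u, cochain u -> cochain (f i u);
    cm_dif : forall i u, cochain u -> f i.+1 (dif u) = dif (f i u)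
  }.

Arguments cm_lin {C D f} _ i.

Lemma cm_cocycle C D (f : forall i, obj C i -> obj D i) :
  chain_map f -> forall i z, cocycle z -> cocycle (f i z).
Proof.
move=> fM i z [Cz dz]; split; first exact: cm_cochain.
by rewrite -(cm_dif fM) // dz (lin0 (cm_lin fM _)).
Qed.

Lemma cm_coboundary C D (f : forall i, obj C i -> obj D i) :
  chain_map f -> forall i z, coboundary z -> coboundary (f i z).
Proof.
move=> fM [|i] z /=; first by move=> ->; rewrite (lin0 (cm_lin fM _)).
case=> w [Cw ->]; exists (f i w); rewrite (cm_dif fM) //.
by split=> //; apply: cm_cochain.
Qed.


(** * Cones of multiplications and Koszul complexes *)

Section Cone.
Variables (a : R) (C : complex).

(** Written without a module in degree -1, so that degree 0 is a special case. *)
Definition cone_obj i : lmodType R :=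
  match i with 0 => obj C 0 | j.+1 => (obj C j.+1 * obj C j)%type end.

Definition cone_dif i : cone_obj i -> cone_obj i.+1 :=
  match i with
  | 0 => fun u => (dif u, a *: u)
  | j.+1 => fun w => (dif w.1, a *: w.1 - dif w.2)
  end.

Definition cone_cochain i : cone_obj i -> Prop :=
  match i with
  | 0 => fun u => cochain u
  | j.+1 => fun w => cochain w.1 /\ cochain w.2
  end.

Fact cone_dif_lin i : linear (@cone_dif i).
Proof.
move=> b; case: i => [|i] /= u v; rewrite !dif_lin; apply: (congr2 pair) => //=.
  by rewrite scalerDr !scalerA mulrC.
rewrite scalerDr opprD addrACA; congr (_ + _).
by rewrite scalerBr !scalerA mulrC.
Qed.

Fact cone_dif_dif i (u : cone_obj i) : cone_dif (cone_dif u) = 0.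
Proof.
case: i u => [|i] /= u; apply: (congr2 pair); rewrite /= ?dif_dif //.
  by rewrite (linZ (@dif_lin C _)) subrr.
by rewrite (linB (@dif_lin C _)) (linZ (@dif_lin C _)) dif_dif subr0 subrr.
Qed.

Fact cone_cochain0 i : @cone_cochain i 0.
Proof. by case: i => [|i] /=; [|split]; apply: cochain0. Qed.

Fact cone_cochain_lin i b (u v : cone_obj i) :
  cone_cochain u -> cone_cochain v -> cone_cochain (b *: u + v).
Proof.
case: i u v => [|i] /= u v; first exact: cochain_lin.
by move=> [? ?] [? ?]; split; apply: cochain_lin.
Qed.

Fact cone_cochain_dif i (u : cone_obj i) :
  cone_cochain u -> cone_cochain (cone_dif u).
Proof.
case: i u => [|i] /= u.
  by move=> Cu; split; [apply: cochain_dif|apply: cochainZ].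
move=> [Cu Cv]; split; first exact: cochain_dif.
by apply: cochainB; [apply: cochainZ|apply: cochain_dif].
Qed.

Definition cone : complex :=
  Complex cone_dif_lin cone_dif_dif cone_cochain0 cone_cochain_lin
    cone_cochain_dif.

Lemma cone_cocycle0 (u : obj C 0) :
  cocycle (u : obj cone 0) <-> cocycle u /\ a *: u = 0.
Proof.
split; first by case=> /= Cu [du au].
by case=> [[Cu du] au]; split=> //=; rewrite du au.
Qed.

Lemma cone_cocycleS i (u : obj C i.+1) (v : obj C i) :
  cocycle ((u, v) : obj cone i.+1) <->
  [/\ cocycle u, cochain v & a *: u = dif v].
Proof.
split; first by case=> /= [[Cu Cv] [du /eqP]]; rewrite subr_eq0 => /eqP.
by case=> [[Cu du] Cv e]; split=> //=; rewrite du e subrr.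
Qed.

(** Trading the second component of a primitive for the condition that a class
    of [C] vanishes removes the case distinction on the degree from every later
    argument about cones. *)
Lemma cone_coboundaryS i (u : obj C i.+1) (v : obj C i) :
  coboundary ((u, v) : obj cone i.+1) <->
  exists p : obj C i, [/\ cochain p, u = dif p & coboundary (v - a *: p)].
Proof.
split.
  case: i u v => [|i] u v /= [p [Cp [-> ->]]]; first by exists p; rewrite subrr.
  case: Cp => Cp Cq; exists p.1; split=> //; exists (- p.2).
  split; first exact: cochainN.
  by rewrite (linN (@dif_lin C _)) addrAC subrr add0r.
case: i u v => [|i] u v /= [p [Cp ->]].
  by move/eqP; rewrite subr_eq0 => /eqP->; exists p.
case=> q [Cq e]; exists (p, - q); split; first split=> //=.
  exact: cochainN.
apply: (congr2 pair) => //=.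
by rewrite (linN (@dif_lin C _)) opprK -e addrC subrK.
Qed.

End Cone.

Definition cone_map a (C D : complex) (f : forall i, obj C i -> obj D i) i :
    obj (cone a C) i -> obj (cone a D) i :=
  match i with
  | 0 => f 0
  | j.+1 => fun w => (f j.+1 w.1, f j w.2)
  end.

Lemma cone_chain_map a C D (f : forall i, obj C i -> obj D i) :
  chain_map f -> chain_map (cone_map (a := a) f).
Proof.
case=> fl fc fd; split=> [[|i] b u v|[|i] u|[|i] u] /=.
- exact: fl.
- by apply: (congr2 pair); rewrite fl.
- exact: fc.
- by case=> ? ?; split; apply: fc.
- by move=> Cu; rewrite fd // (linZ (fl _)).
- by case=> Cu Cv; rewrite fd // (linB (fl _)) (linZ (fl _)) fd.
Qed.

(** The Koszul cochain complex of the sequence s with coefficients in C, as an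
    iterated cone: no exterior algebra, hence no signs beyond the one in
    [cone_dif]. *)
Fixpoint koszul (s : seq R) (C : complex) : complex :=
  if s is a :: s' then koszul s' (cone a C) else C.

Fixpoint koszul_map (s : seq R) (C D : complex)
    (f : forall i, obj C i -> obj D i) :
    forall i, obj (koszul s C) i -> obj (koszul s D) i :=
  if s is a :: s' then koszul_map (s := s') (cone_map (a := a) f) else f.

Lemma koszul_map_scale x s C (f : forall i, obj C i -> obj C i) :
  (forall i u, f i u = x *: u) ->
  forall i u, koszul_map (s := s) f (i := i) u = x *: u.
Proof.
elim: s C f => [|a s IHs] C f fx //=; apply: IHs.
by case=> [|i] u; [apply: fx | apply: (congr2 pair); rewrite fx].
Qed.


(** * Short exact sequences of complexes *)

Record short_exact (A B C : complex) (f : forall i, obj A i -> obj B i)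
    (g : forall i, obj B i -> obj C i) : Prop := ShortExact {
  se_f : chain_map f;
  se_g : chain_map g;
  se_inj : forall i u, cochain u -> f i u = 0 -> u = 0;
  se_gf : forall i u, g i (f i u) = 0;
  se_exact : forall i v, cochain v -> g i v = 0 ->
    exists u, cochain u /\ v = f i u;
  se_surj : forall i w, cochain w -> exists v, cochain v /\ g i v = w
}.

Lemma cone_short_exact a A B C (f : forall i, obj A i -> obj B i)
    (g : forall i, obj B i -> obj C i) :
  short_exact f g ->
  short_exact (cone_map (a := a) f) (cone_map (a := a) g).
Proof.
case=> fM gM inj gf ex surj; split; try exact: cone_chain_map.
- case=> [|i] /= => [|[u v] /= [Cu Cv] [fu fv]]; first exact: inj.
  by rewrite (inj _ _ Cu fu) (inj _ _ Cv fv).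
- by case=> [|i] /= u; rewrite !gf.
- case=> [|i] /= => [|[u v] /= [Cu Cv] [fu fv]]; first exact: ex.
  have [u' [? ->]] := ex _ _ Cu fu; have [v' [? ->]] := ex _ _ Cv fv.
  by exists (u', v').
- case=> [|i] /= => [|[u v] /= [Cu Cv]]; first exact: surj.
  have [u' [? <-]] := surj _ _ Cu; have [v' [? <-]] := surj _ _ Cv.
  by exists (u', v').
Qed.

(** This is exactness of the long cohomology sequence at H^i(A): a class that
    dies in H^i(B) comes from H^(i-1)(C). *)
Lemma short_exact_coboundary A B C (f : forall i, obj A i -> obj B i)
    (g : forall i, obj B i -> obj C i) i (z : obj A i) :
  short_exact f g -> (forall j, i = j.+1 -> acyclic C j) ->
  cocycle z -> coboundary (f i z) -> coboundary z.
Proof.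
case=> fM gM inj gf ex surj; case: i z => [|i] z acC [Cz dz] /=.
  exact: inj.
case=> y [Cy fz].
have gy : cocycle (g i y).
  by split; [apply: cm_cochain | rewrite -(cm_dif gM) // -fz gf].
have [b [Cb [gb db]]] : exists b, cochain b /\ g i b = g i y /\ dif b = 0.
  have := acC i erefl _ gy.
  case: i z acC Cz dz y Cy fz gy => [|i] z acC Cz dz y Cy fz gy /=.
    move=> gy0; exists 0; split; first exact: cochain0.
    by rewrite (lin0 (@dif_lin B _)) (lin0 (cm_lin gM _)) gy0.
  case=> c [/surj[b [Cb <-]] e]; exists (dif b).
  by rewrite (cm_dif gM) // e dif_dif; split=> //; apply: cochain_dif.
have [] := ex i (y - b); first exact: cochainB.
  by rewrite (linB (cm_lin gM _)) gb subrr.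
move=> u [Cu e]; exists u; split=> //; apply/eqP; rewrite -subr_eq0; apply/eqP.
apply: inj; first by apply: cochainB => //; apply: cochain_dif.
rewrite (linB (cm_lin fM _)) fz (cm_dif fM) // -e (linB (@dif_lin B _)) db.
by rewrite subr0 subrr.
Qed.

Lemma short_exact_acyclic_middle A B C (f : forall i, obj A i -> obj B i)
    (g : forall i, obj B i -> obj C i) i :
  short_exact f g -> acyclic A i -> acyclic C i -> acyclic B i.
Proof.
case=> fM gM inj gf ex surj acA acC z zz; have [Cz dz] := zz.
have [y [Cy [byz gy]]] :
    exists y, cochain y /\ coboundary (z - y) /\ g i y = 0.
  have := acC _ (cm_cocycle gM zz).
  case: i z {acA acC} zz Cz dz => [|i] z zz Cz dz /=.
    by move=> gz; exists z; rewrite subrr.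
  case=> c [/surj[b [Cb <-]] e]; exists (z - dif b).
  split; first by apply: cochainB => //; apply: cochain_dif.
  rewrite opprB addrC subrK (linB (cm_lin gM _)) e (cm_dif gM) // subrr.
  by split=> //; exists b.
have dy : dif y = 0.
  suff: dif (z - y) = 0.
    by rewrite (linB (@dif_lin B _)) dz sub0r => /eqP; rewrite oppr_eq0 => /eqP.
  case: i z y {acA acC zz Cz dz Cy gy} byz => [|i] z y /=.
    by move->; rewrite (lin0 (@dif_lin B _)).
  by case=> w [_ ->]; rewrite dif_dif.
have [u [Cu e]] := ex _ _ Cy gy.
rewrite -[z](subrK y) e; apply: coboundaryD; first by rewrite -e.
apply: (cm_coboundary fM); apply: acA; split=> //.
apply: inj; first exact: cochain_dif.
by rewrite (cm_dif fM) // -e.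
Qed.

Lemma koszul_short_exact s A B C (f : forall i, obj A i -> obj B i)
    (g : forall i, obj B i -> obj C i) :
  short_exact f g -> short_exact (koszul_map (s := s) f) (koszul_map (s := s) g).
Proof.
elim: s A B C f g => [|a s IHs] A B C f g fg //=.
exact: IHs (cone_short_exact a fg).
Qed.


(** * Elements acting nilpotently on cohomology *)

Definition cohomology_nilpotent (x : R) (C : complex) : Prop :=
  forall i (z : obj C i), cocycle z -> exists m, coboundary (x ^+ m *: z).

(** Multiplication by x^r is null-homotopic on its own cone; the homotopy sends
    (u, v) to (v, 0). *)
Lemma cone_power_nilpotent x r C : cohomology_nilpotent x (cone (x ^+ r) C).
Proof.
case=> [|i] z; first by case/cone_cocycle0=> _ xz; exists r.
case: z => u v /cone_cocycleS[_ Cv e]; exists r.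
rewrite -[_ *: _]/((x ^+ r *: u, x ^+ r *: v) : obj (cone (x ^+ r) C) i.+1).
apply/cone_coboundaryS; exists v; rewrite subrr e.
by split=> //; apply: coboundary0.
Qed.

(** The cohomology of a cone is an extension of a submodule of H(C) by a
    quotient of H(C), so exponents add up. *)
Lemma cone_nilpotent x a C :
  cohomology_nilpotent x C -> cohomology_nilpotent x (cone a C).
Proof.
move=> nilC [|i] z; first by case/cone_cocycle0=> /nilC.
case: z => u v /cone_cocycleS[zu Cv e].
have [m [p [Cp xu]]] := nilC _ _ zu.
have [|m' bw] := nilC i (x ^+ m *: v - a *: p).
  split; first by apply: cochainB; apply: cochainZ.
  rewrite (linB (@dif_lin C _)) !(linZ (@dif_lin C _)) -xu -e !scalerA.
  by rewrite mulrC subrr.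
exists (m' + m)%N; set y := _ ^+ _.
rewrite -[_ *: _]/((y *: u, y *: v) : obj (cone a C) i.+1).
apply/cone_coboundaryS; exists (x ^+ m' *: p); split; first exact: cochainZ.
  by rewrite (linZ (@dif_lin C _)) -xu scalerA -exprD.
by move: bw; rewrite scalerBr !scalerA -exprD [x ^+ m' * a]mulrC.
Qed.

Lemma koszul_nilpotent x s C :
  cohomology_nilpotent x C -> cohomology_nilpotent x (koszul s C).
Proof. by elim: s C => [|a s IHs] C //= nC; apply/IHs/cone_nilpotent. Qed.

Lemma koszul_power_nilpotent x r s C :
  x ^+ r \in s -> cohomology_nilpotent x (koszul s C).
Proof.
elim: s C => [|a s IHs] C //=; rewrite inE => /predU1P[<-|]; last exact: IHs.
exact/koszul_nilpotent/cone_power_nilpotent.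
Qed.


(** * Quasi-isomorphisms *)

Definition quasi_iso C D (f : forall i, obj C i -> obj D i) : Prop :=
  chain_map f /\
  forall i,
    (forall z : obj C i, cocycle z -> coboundary (f i z) -> coboundary z) /\
    (forall y : obj D i, cocycle y ->
       exists z : obj C i, cocycle z /\ coboundary (y - f i z)).

Lemma quasi_iso_acyclic C D (f : forall i, obj C i -> obj D i) i :
  quasi_iso f -> acyclic C i <-> acyclic D i.
Proof.
case=> fM /(_ i)[finj fsurj]; split=> ac z zz.
  have [y [/ac/(cm_coboundary fM) by_ bz]] := fsurj _ zz.
  by rewrite -[z](subrK (f i y)); apply: coboundaryD.
by apply: finj => //; apply/ac/cm_cocycle.
Qed.

(** The five lemma for the long exact sequences of the two cones, written out on
    cocycles. *)
Lemma cone_quasi_iso a C D (f : forall i, obj C i -> obj D i) :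
  quasi_iso f -> quasi_iso (cone_map (a := a) f).
Proof.
case=> fM fqi; split=> [|[|i]]; first exact: cone_chain_map.
- have [finj fsurj] := fqi 0; split=> z /cone_cocycle0[zz az].
    exact: finj.
  have [y [zy /eqP]] := fsurj _ zz; rewrite subr_eq0 => /eqP e.
  exists y; split=> /=; last by apply/eqP; rewrite subr_eq0 e.
  apply/cone_cocycle0; split=> //; apply: finj; first exact: cocycleZ.
  by rewrite /= (linZ (cm_lin fM _)) -e.
have [finj fsurj] := fqi i.+1; have [finj' fsurj'] := fqi i.
split=> -[u v] /cone_cocycleS[[Cu du] Cv e].
  case/cone_coboundaryS=> p [Cp fu bv].
  have [u0 [Cu0 u0E]] : coboundary u by apply: finj => //; exists p.
  have [|c [[Cc dc] bc]] := fsurj' (f i u0 - p).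
    split; first by apply: cochainB => //; apply: cm_cochain.
    by rewrite (linB (@dif_lin D _)) -(cm_dif fM) // -u0E fu subrr.
  have Cuc : cochain (u0 - c) by apply: cochainB.
  apply/cone_coboundaryS; exists (u0 - c); split=> //.
    by rewrite (linB (@dif_lin C _)) dc subr0.
  apply: finj'.
    split; first by apply: cochainB => //; apply: cochainZ.
    rewrite (linB (@dif_lin C _)) (linZ (@dif_lin C _)) (linB (@dif_lin C _)).
    by rewrite dc subr0 -u0E e subrr.
  rewrite (linB (cm_lin fM _)) (linZ (cm_lin fM _)) (linB (cm_lin fM _)).
  have := coboundary_lin (- a) bc bv; congr coboundary.
  rewrite scaleNr !scalerBr addrC -!addrA; congr (_ + _).
  by rewrite -opprD addrCA addNKr.
have [|u1 [zu1 [p [Cp pE]]]] := fsurj u; first by split.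
have Cvp : cochain (v - a *: p) by apply: cochainB => //; apply: cochainZ.
have dvp : dif (v - a *: p) = f i.+1 (a *: u1).
  rewrite (linB (@dif_lin D _)) (linZ (@dif_lin D _)) -e -pE scalerBr.
  by rewrite (linZ (cm_lin fM _)) opprB addrCA subrr addr0.
have [v1 [Cv1 v1E]] : coboundary (a *: u1).
  apply: finj; first exact: cocycleZ.
  by exists (v - a *: p).
have [|c [[Cc dc] bc]] := fsurj' (v - a *: p - f i v1).
  split; first by apply: cochainB => //; apply: cm_cochain.
  by rewrite (linB (@dif_lin D _)) dvp v1E (cm_dif fM) // subrr.
exists (u1, v1 + c); split.
  apply/cone_cocycleS; split=> //; first exact: cochainD.
  by rewrite (linD (@dif_lin C _)) dc addr0.
apply/cone_coboundaryS; exists p; split=> //.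
move: bc; congr coboundary; rewrite /= (linD (cm_lin fM _)) opprD -!addrA.
by congr (_ + _); rewrite addrCA; congr (_ + _); rewrite addrC.
Qed.

Lemma koszul_quasi_iso s C D (f : forall i, obj C i -> obj D i) :
  quasi_iso f -> quasi_iso (koszul_map (s := s) f).
Proof.
elim: s C D f => [|a s IHs] C D f fq //=.
exact: IHs (cone_quasi_iso a fq).
Qed.

Lemma koszul_acyclic_quasi_iso s C D (f : forall i, obj C i -> obj D i) i :
  quasi_iso f -> acyclic (koszul s C) i <-> acyclic (koszul s D) i.
Proof. by move/(koszul_quasi_iso s); apply: quasi_iso_acyclic. Qed.


(** * Subcomplexes of annihilated cochains *)

Section Annihilator.
Variables (t : seq R) (C : complex).

Definition ann_cochain i (u : obj C i) : Prop :=
  cochain u /\ forall a, a \in t -> a *: u = 0.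

Fact ann_cochain0 i : @ann_cochain i 0.
Proof. by split=> [|a _]; [apply: cochain0|rewrite scaler0]. Qed.

Fact ann_cochain_lin i b (u v : obj C i) :
  ann_cochain u -> ann_cochain v -> ann_cochain (b *: u + v).
Proof.
move=> [Cu au] [Cv av]; split=> [|a ta]; first exact: cochain_lin.
by rewrite scalerDr scalerA mulrC -scalerA au // av // scaler0 addr0.
Qed.

Fact ann_cochain_dif i (u : obj C i) : ann_cochain u -> ann_cochain (dif u).
Proof.
case=> Cu au; split=> [|a ta]; first exact: cochain_dif.
by rewrite -(linZ (@dif_lin C _)) au // (lin0 (@dif_lin C _)).
Qed.

Definition annihilator : complex :=
  Complex (@dif_lin C) (@dif_dif C) ann_cochain0 ann_cochain_lin
    ann_cochain_dif.

End Annihilator.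

(** The inclusion of the kernel of a into the cone of a, which is the homotopy
    kernel. *)
Definition ann_to_cone t a C i :
    obj (annihilator (rcons t a) C) i -> obj (cone a (annihilator t C)) i :=
  match i with 0 => fun u => u | j.+1 => fun u => (u, 0) end.

(** When a is surjective in every degree, its homotopy kernel is its kernel. *)
Lemma ann_quasi_iso t a C :
  (forall i (z : obj (annihilator t C) i), cochain z ->
     exists w : obj (annihilator t C) i, cochain w /\ a *: w = z) ->
  quasi_iso (@ann_to_cone t a C).
Proof.
move=> adiv.
have annS i (u : obj C i) : ann_cochain (rcons t a) u <->
    ann_cochain t u /\ a *: u = 0.
  split=> [[Cu au]|[[Cu tu] au]].
    split; last by apply: au; rewrite mem_rcons mem_head.
    by split=> // b tb; apply: au; rewrite mem_rcons inE tb orbT.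
  by split=> // b; rewrite mem_rcons inE => /predU1P[->|/tu].
split.
  split=> [[|i] b u v|[|i] u|[|i] u] //=.
  - by apply: (congr2 pair); rewrite //= scaler0 addr0.
  - by case/annS.
  - by case/annS=> ? ?; split=> //; apply: ann_cochain0.
  - by case/annS=> _ ->.
  - case/annS=> _ ->; apply: (congr2 pair) => //=.
    by rewrite (lin0 (@dif_lin C _)) subrr.
case=> [|i]; split=> z.
- by case.
- case/cone_cocycle0=> -[Cz dz] az; exists z; split; last exact: subrr.
  by split=> //; apply/annS.
- move=> -[/annS[Cz az] dz] /cone_coboundaryS[p [Cp zE]].
  rewrite sub0r; case: i z Cz az dz p Cp zE => [|i] z Cz az dz p Cp zE /=.
    move=> ap; exists p; split=> //; apply/annS; split=> //.
    by apply/eqP; rewrite -oppr_eq0 ap.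
  case=> q [/adiv[q' [Cq' <-]] apE]; exists (p + dif q'); split.
    have Cdq' := ann_cochain_dif Cq'.
    apply/annS; split.
      exact: (@cochainD (annihilator t C) _ p (dif q') Cp Cdq').
    by rewrite scalerDr -(linZ (@dif_lin C _)) -apE subrr.
  by rewrite (linD (@dif_lin C _)) dif_dif addr0.
case: z => u v /cone_cocycleS[[Cu du] /adiv[w [Cw <-]] auE].
have Cdw := ann_cochain_dif Cw.
exists (u - dif w); split.
  split; last by rewrite /= (linB (@dif_lin C _)) dif_dif subr0.
  apply/annS; split.
    exact: (@cochainB (annihilator t C) _ u (dif w) Cu Cdw).
  by rewrite scalerBr auE /= (linZ (@dif_lin C _)) subrr.
rewrite -[_ - _]/((u - (u - dif w), a *: w - 0) :
  obj (cone a (annihilator t C)) i.+1) opprB addrC subrK subr0.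
apply/cone_coboundaryS; exists w; split=> //.
by rewrite subrr; apply: coboundary0.
Qed.



(** The elements of s are moved one after the other from the Koszul complex to
    the annihilator; each move is a quasi-isomorphism because the next element
    is surjective on what the previous ones annihilate. *)
Lemma annihilator_acyclic s t C i :
  (forall t1 a t2, t ++ s = t1 ++ a :: t2 ->
     forall j (z : obj C j), ann_cochain t1 z ->
       exists w : obj C j, ann_cochain t1 w /\ a *: w = z) ->
  acyclic (koszul s (annihilator t C)) i -> acyclic (annihilator (t ++ s) C) i.
Proof.
elim: s t => [|a s IHs] t /= adiv; first by rewrite cats0.
rewrite -cat_rcons => ac; apply: IHs; first by rewrite cat_rcons.
have qi : quasi_iso (@ann_to_cone t a C) by apply/ann_quasi_iso/adiv.
exact/(koszul_acyclic_quasi_iso s i qi).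
Qed.


(** * Modules and injective resolutions as complexes *)

Section SingleModule.
Variable M : lmodType R.

Definition single_cochain i (u : M) : Prop :=
  if i is _.+1 then u = 0 else True.

Fact single_dif_lin (i : nat) : linear (fun _ : M => 0 : M).
Proof. by move=> a u v; rewrite scaler0 addr0. Qed.

Fact single_cochain_lin i a (u v : M) :
  single_cochain i u -> single_cochain i v -> single_cochain i (a *: u + v).
Proof. by case: i => //= _ -> ->; rewrite scaler0 addr0. Qed.

(** M in degree 0. Every [obj i] is M itself, and [cochain] leaves only 0 in
    positive degrees. *)
Definition single : complex :=
  @Complex (fun=> M) (fun _ _ => 0) single_cochain single_dif_lin
    (fun _ _ => erefl) (fun i => if i is _.+1 then erefl else I)
    single_cochain_lin (fun _ _ _ => erefl).

End SingleModule.

Lemma single_short_exact (A B C : lmodType R) (f : A -> B) (g : B -> C) :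
  linear f -> linear g -> injective f -> (forall u, g (f u) = 0) ->
  (forall v, g v = 0 -> exists u, v = f u) -> (forall w, exists v, g v = w) ->
  @short_exact (single A) (single B) (single C) (fun=> f) (fun=> g).
Proof.
move=> fl gl finj gf ex surj.
have f0 := lin0 fl; have g0 := lin0 gl.
split=> //.
- by split=> // -[|i] //= u ->; rewrite f0.
- by split=> // -[|i] //= u ->; rewrite g0.
- by move=> i u _; rewrite -f0 => /finj.
- move=> [|i] v /=; first by move=> _ /ex[u ->]; exists u.
  by move=> -> _; exists 0; rewrite f0.
- move=> [|i] w /=; first by move=> _; have [v <-] := surj w; exists v.
  by move=> ->; exists 0; rewrite g0.
Qed.

Section Resolution.
Variables (M : lmodType R) (E : injective_resolution M).

Fact resolution_dif_dif i (u : ires_obj E i) :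
  ires_diff E i.+1 (ires_diff E i u) = 0.
Proof. by apply/ires_exactS; exists u. Qed.

Definition resolution : complex :=
  @Complex (ires_obj E) (fun i => ires_diff E i) (fun _ _ => True)
    (fun i => linearP (ires_diff E i)) resolution_dif_dif (fun=> I)
    (fun _ _ _ _ _ _ => I) (fun _ _ _ => I).

Definition augmentation i : M -> ires_obj E i :=
  if i is 0 then ires_aug E else fun=> 0.

(** Exactness of E kills its cohomology in positive degrees, and identifies the
    kernel in degree 0 with M. *)
Lemma augmentation_quasi_iso :
  @quasi_iso (single M) resolution augmentation.
Proof.
split.
  split=> [[|i] a u v|//|[|i] u _] /=.
  - exact: linearP.
  - by rewrite scaler0 addr0.
  - by apply/esym/ires_exact0; exists u.
  - by rewrite linear0.
case=> [|i]; split=> z /= [Cz dz].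
- by rewrite -(linear0 (ires_aug E)) => /ires_aug_inj.
- by have /ires_exact0[x ->] := dz; exists x; rewrite subrr.
- by move=> _; rewrite Cz; apply: (@coboundary0 (single M) i.+1).
- have /ires_exactS[w ->] := dz; exists 0; split=> //.
  by exists w; rewrite subr0.
Qed.

End Resolution.

End Complexes.

(** * Quotients by ideals given by generators *)

Section IdealSpan.
Local Open Scope ring_scope.
Variable R : comNzRingType.
Implicit Types A B : R -> Prop.

Lemma ideal_span_gen A g : A g -> g \in ideal_span A.
Proof.
move=> Ag; apply/asboolP; exists 1%N, (fun=> 1), (fun=> g).
by rewrite big_ord1 mul1r.
Qed.

Lemma ideal_span0 A : 0 \in ideal_span A.
Proof. by case: (ideal_span_submod_closed A). Qed.

Lemma ideal_spanD A p q :
  p \in ideal_span A -> q \in ideal_span A -> p + q \in ideal_span A.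
Proof.
case: (ideal_span_submod_closed A) => _ AL Ap Aq.
by rewrite -[p](scale1r (p : R^o)); apply: AL.
Qed.

Lemma ideal_spanM A c p : p \in ideal_span A -> c * p \in ideal_span A.
Proof.
case: (ideal_span_submod_closed A) => A0 AL Ap.
by rewrite -[_ * _]addr0; apply: (AL c).
Qed.

Lemma ideal_spanMr A c p : p \in ideal_span A -> p * c \in ideal_span A.
Proof. by rewrite mulrC; apply: ideal_spanM. Qed.

Lemma ideal_spanN A p : p \in ideal_span A -> - p \in ideal_span A.
Proof. by rewrite -mulN1r; apply: ideal_spanM. Qed.

Lemma ideal_spanB A p q :
  p \in ideal_span A -> q \in ideal_span A -> p - q \in ideal_span A.
Proof. by move=> Ap Aq; apply/ideal_spanD/ideal_spanN. Qed.

Lemma ideal_span_ind A (P : R -> Prop) :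
  P 0 -> (forall p q, P p -> P q -> P (p + q)) ->
  (forall c g, A g -> P (c * g)) -> forall p, p \in ideal_span A -> P p.
Proof.
move=> P0 PD PM p /asboolP[m [c [g [Ag ->]]]].
by elim/big_ind: _ => // i _; apply: PM.
Qed.

Lemma ideal_span_sub A B :
  (forall g, A g -> g \in ideal_span B) ->
  forall p, p \in ideal_span A -> p \in ideal_span B.
Proof.
move=> AB; apply: ideal_span_ind; first exact: ideal_span0.
  exact: ideal_spanD.
by move=> c g /AB; apply: ideal_spanM.
Qed.

Lemma ideal_span_morph (f : {rmorphism R -> R}) A B :
  (forall g, A g -> f g \in ideal_span B) ->
  forall p, p \in ideal_span A -> f p \in ideal_span B.
Proof.
move=> AB; apply: ideal_span_ind; first by rewrite rmorph0 ideal_span0.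
  by move=> p q; rewrite rmorphD; apply: ideal_spanD.
by move=> c g /AB; rewrite rmorphM; apply: ideal_spanM.
Qed.

Definition ideal_quotient A : lmodType R :=
  @quot_module R R^o (ideal_span A) (ideal_span_submod_closed A).

Definition residue A (p : R) : ideal_quotient A :=
  \pi_(Quotient.quot (submod_zmod (ideal_span_submod_closed A)))%qT (p : R^o).

Definition lift A (u : ideal_quotient A) : R :=
  (repr (u : Quotient.quot (submod_zmod (ideal_span_submod_closed A))) : R^o).

Lemma liftK A : cancel (@lift A) (residue A).
Proof. exact: reprK. Qed.

Lemma residue_eq A p q : (residue A p == residue A q) = (p - q \in ideal_span A).
Proof. exact: quot_pi_eq. Qed.

Lemma residue_lin A : linear (residue A : R^o -> ideal_quotient A).
Proof.
move=> a p q.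
by rewrite /residue quot_piD -(quot_scale_pi (ideal_span_submod_closed A)).
Qed.

Lemma residueZ A a p : residue A (a * p) = a *: residue A p.
Proof. exact: (linZ (@residue_lin A)). Qed.

Lemma residue_eq0 A p : (residue A p == 0) = (p \in ideal_span A).
Proof. by rewrite -(lin0 (@residue_lin A)) residue_eq subr0. Qed.

Lemma lift_residue A p : lift (residue A p) - p \in ideal_span A.
Proof. by rewrite -residue_eq liftK. Qed.

Section ResidueMap.
Variables (A B : R -> Prop).
Hypothesis AB : forall p, p \in ideal_span A -> p \in ideal_span B.

Definition residue_map (u : ideal_quotient A) : ideal_quotient B :=
  residue B (lift u).

Lemma residue_mapE p : residue_map (residue A p) = residue B p.
Proof. by apply/eqP; rewrite residue_eq; apply/AB/lift_residue. Qed.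

Lemma residue_map_lin : linear residue_map.
Proof.
move=> a u v; rewrite -[u]liftK -[v]liftK -(@residue_lin A) !residue_mapE.
exact: residue_lin.
Qed.

End ResidueMap.

End IdealSpan.

(** * Depth bounds through Koszul cohomology *)

Section KoszulDepth.
Local Open Scope ring_scope.
Variables (R : comNzRingType) (s : seq R).

Definition koszul_depth_ge (k : nat) (M : lmodType R) : Prop :=
  forall i, (i < k)%N -> acyclic (koszul s (single M)) i.

Lemma koszul_depth_ge_short_exact k (A B C : lmodType R) (f : A -> B)
    (g : B -> C) :
  linear f -> linear g -> injective f -> (forall u, g (f u) = 0) ->
  (forall v, g v = 0 -> exists u, v = f u) -> (forall w, exists v, g v = w) ->
  koszul_depth_ge k B -> koszul_depth_ge k.-1 C -> koszul_depth_ge k A.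
Proof.
move=> fl gl finj gf ex surj kB kC i ik z zz.
have se := koszul_short_exact s (single_short_exact fl gl finj gf ex surj).
apply: (short_exact_coboundary se) => // [j e|].
  by apply: kC; move: ik; rewrite e; case: (k).
by apply: (kB i ik); apply: cm_cocycle => //; apply: se_f se.
Qed.

Lemma koszul_depth_ge_prod k (M N : lmodType R) :
  koszul_depth_ge k M -> koszul_depth_ge k N ->
  koszul_depth_ge k (M * N)%type.
Proof.
move=> kM kN i ik.
pose f (u : M) : (M * N)%type := (u, 0); pose g (w : (M * N)%type) : N := w.2.
have fl : linear f.
  by move=> a u v; apply: (congr2 pair); rewrite //= scaler0 addr0.
have gl : linear g by [].
have se : @short_exact R (single M) (single (M * N)%type) (single N)
    (fun=> f) (fun=> g).
  apply: single_short_exact => //.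
  - by move=> u v [].
  - by move=> [u v] /= vz; exists u; rewrite /f -vz.
  - by move=> w; exists (0, w).
apply: (short_exact_acyclic_middle (koszul_short_exact s se)).
  exact: kM.
exact: kN.
Qed.

(** Since x acts injectively on Koszul cohomology in degrees at most k, by the
    long exact sequence, and nilpotently because a power of x belongs to s, the
    cohomology is zero there. *)
Lemma koszul_depth_ge_regular x r k (M C : lmodType R) (g : M -> C) :
  x ^+ r \in s -> (forall u : M, x *: u = 0 -> u = 0) -> linear g ->
  (forall u, g (x *: u) = 0) -> (forall v, g v = 0 -> exists u, v = x *: u) ->
  (forall w, exists v, g v = w) ->
  koszul_depth_ge k C -> koszul_depth_ge k.+1 M.
Proof.
move=> xs xreg gl gx ex surj kC i; rewrite ltnS => ik z zz.
have xl : linear (fun u : M => x *: u).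
  by move=> a u v; rewrite scalerDr !scalerA mulrC.
have xinj : injective (fun u : M => x *: u).
  move=> u v /eqP; rewrite -subr_eq0 -scalerBr => /eqP/xreg/eqP.
  by rewrite subr_eq0 => /eqP.
have se := koszul_short_exact s (single_short_exact xl gl xinj gx ex surj).
have step y : cocycle y -> coboundary (x *: y) ->
    @coboundary _ (koszul s (single M)) i y.
  move=> zy byx; apply: (short_exact_coboundary se) => // [j e|].
    by apply: kC; rewrite -e in ik *.
  by rewrite (koszul_map_scale (x := x)).
have [m] := koszul_power_nilpotent xs zz.
elim: m => [|m IHm]; first by rewrite expr0 scale1r.
rewrite exprS -scalerA => /step; move/(_ (cocycleZ _ zz)); exact: IHm.
Qed.

Definition depth_ge (k : nat) (A : R -> Prop) : Prop :=
  koszul_depth_ge k (ideal_quotient A).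

Lemma depth_ge_leq k l A : (k <= l)%N -> depth_ge l A -> depth_ge k A.
Proof. by move=> kl dl i /leq_trans/(_ kl); apply: dl. Qed.

(** Different generators of the same ideal define equal quotient modules. *)
Lemma depth_ge_eq k (A B : R -> Prop) :
  (forall p, p \in ideal_span A <-> p \in ideal_span B) ->
  depth_ge k A -> depth_ge k B.
Proof.
move=> AB; rewrite /depth_ge /ideal_quotient.
have e : ideal_span A = ideal_span B.
  by apply/funext=> p; apply/idP/idP => /AB.
move: (ideal_span_submod_closed A) (ideal_span_submod_closed B).
by rewrite e => H1 H2; rewrite (Prop_irrelevance H1 H2).
Qed.

(** The depth lemma for 0 -> R/I -> R/A x R/B -> R/C -> 0, where C generates the
    sum of the ideals of A and B. *)
Lemma depth_ge_inter k (I A B C : R -> Prop) :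
  (forall p, p \in ideal_span I <-> p \in ideal_span A /\ p \in ideal_span B) ->
  (forall p, p \in ideal_span A -> p \in ideal_span C) ->
  (forall p, p \in ideal_span B -> p \in ideal_span C) ->
  (forall g, C g -> g \in ideal_span A \/ g \in ideal_span B) ->
  depth_ge k A -> depth_ge k B -> depth_ge k.-1 C -> depth_ge k I.
Proof.
move=> IAB AC BC CAB.
have IA p : p \in ideal_span I -> p \in ideal_span A by case/IAB.
have IB p : p \in ideal_span I -> p \in ideal_span B by case/IAB.
have CE p : p \in ideal_span C -> exists2 q, q \in ideal_span A &
    p - q \in ideal_span B.
  move: p; apply: ideal_span_ind.
  - by exists 0; rewrite ?subrr ideal_span0.
  - move=> p q [u Au Bu] [v Av Bv]; exists (u + v); first exact: ideal_spanD.
    by rewrite opprD addrACA; apply: ideal_spanD.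
  - move=> c g /CAB[Ag|Bg].
      by exists (c * g); rewrite ?subrr ?ideal_span0 // ideal_spanM.
    by exists 0; rewrite ?subr0 ?ideal_span0 // ideal_spanM.
pose AB := (ideal_quotient A * ideal_quotient B)%type.
pose f (u : ideal_quotient I) : AB := (residue_map A u, residue_map B u).
pose g (w : AB) : ideal_quotient C := residue_map C w.1 - residue_map C w.2.
move=> kA kB kC; have kAB := koszul_depth_ge_prod kA kB.
apply: (@koszul_depth_ge_short_exact k _ _ _ f g _ _ _ _ _ _ kAB kC).
- move=> a u v; apply: (congr2 pair); exact: residue_map_lin.
- move=> a u v; rewrite /g /= !residue_map_lin // scalerBr opprD addrACA.
  by [].
- move=> u v [/eqP]; rewrite -[u]liftK -[v]liftK !residue_mapE // residue_eq.
  move=> Auv /eqP; rewrite residue_eq => Buv; apply/eqP.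
  by rewrite residue_eq; apply/IAB.
- by move=> u; rewrite -[u]liftK /f /g /= !residue_mapE // subrr.
- move=> [u v]; rewrite -[u]liftK -[v]liftK /g /= !residue_mapE //.
  move/eqP; rewrite subr_eq0 residue_eq => /CE[q Aq Bq].
  exists (residue I (lift u - q)); rewrite /f !residue_mapE //.
  congr (_, _); apply/eqP; rewrite residue_eq.
    by rewrite opprB addrC subrK.
  by rewrite -opprB ideal_spanN // addrAC.
- move=> w; exists (residue A (lift w), 0); rewrite /g /= residue_mapE // liftK.
  by rewrite (lin0 (residue_map_lin BC)) subr0.
Qed.

Lemma depth_ge_regular k x r (A B : R -> Prop) :
  x ^+ r \in s ->
  (forall p, x * p \in ideal_span A -> p \in ideal_span A) ->
  (forall g, B g <-> A g \/ g = x) ->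
  depth_ge k B -> depth_ge k.+1 A.
Proof.
move=> xs xreg BA.
have Bx : x \in ideal_span B by apply: ideal_span_gen; apply/BA; right.
have AB p : p \in ideal_span A -> p \in ideal_span B.
  by apply: ideal_span_sub => g Ag; apply: ideal_span_gen; apply/BA; left.
have BAx p : p \in ideal_span B -> exists q, p - x * q \in ideal_span A.
  move: p; apply: ideal_span_ind.
  - by exists 0; rewrite mulr0 subrr ideal_span0.
  - move=> p q [u Au] [v Av]; exists (u + v); rewrite mulrDr opprD addrACA.
    exact: ideal_spanD.
  - move=> c g /BA[Ag|->].
      by exists 0; rewrite mulr0 subr0; apply/ideal_spanM/ideal_span_gen.
    by exists c; rewrite mulrC subrr ideal_span0.
apply: (koszul_depth_ge_regular xs) (residue_map_lin AB) _ _ _.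
- move=> u; rewrite -[u]liftK -residueZ => /eqP; rewrite residue_eq0 => /xreg.
  by rewrite -residue_eq0 => /eqP.
- move=> u; rewrite -[u]liftK -residueZ residue_mapE //; apply/eqP.
  by rewrite residue_eq0 mulrC ideal_spanM.
- move=> v; rewrite -[v]liftK residue_mapE // => /eqP; rewrite residue_eq0.
  case/BAx=> q vq; exists (residue A q); apply/eqP.
  by rewrite -residueZ residue_eq.
- by move=> w; exists (residue A (lift w)); rewrite residue_mapE // liftK.
Qed.

End KoszulDepth.


(** * From Koszul cohomology to local cohomology *)

Section LocalCohomologyVanishing.
Local Open Scope ring_scope.
Variable R : comNzRingType.

Definition regular_sequence (s : seq R) : Prop :=
  forall t1 a t2, s = t1 ++ a :: t2 -> forall p,
    a * p \in ideal_span (fun b => b \in t1) ->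
    p \in ideal_span (fun b => b \in t1).

(** Multiplication by a is injective on R/(t), so the map R/(t) -> E that sends
    1 to z extends along it; the image of 1 under the extension is w. *)
Lemma injective_module_divisible (E : lmodType R) (t : seq R) (a : R) (z : E) :
  injective_module E ->
  (forall p, a * p \in ideal_span (fun b => b \in t) ->
     p \in ideal_span (fun b => b \in t)) ->
  (forall b, b \in t -> b *: z = 0) ->
  exists w : E, (forall b, b \in t -> b *: w = 0) /\ a *: w = z.
Proof.
move=> Einj areg tz; pose Q := ideal_quotient (fun b => b \in t).
have tz0 p : p \in ideal_span (fun b => b \in t) -> p *: z = 0.
  move: p; apply: ideal_span_ind; first by rewrite scale0r.
    by move=> p q pz qz; rewrite scalerDl pz qz addr0.
  by move=> c g gt; rewrite -scalerA tz ?scaler0.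
pose m (u : Q) : Q := a *: u; pose f (u : Q) : E := lift u *: z.
have ml : linear m by move=> c u v; rewrite /m scalerDr !scalerA mulrC.
have fE p : f (residue _ p) = p *: z.
  by apply/eqP; rewrite -subr_eq0 -scalerBl; apply/eqP/tz0/lift_residue.
have fl : linear f.
  move=> c u v; rewrite -[u]liftK -[v]liftK -(@residue_lin R) !fE.
  by rewrite scalerDl scalerA.
have minj : injective (to_linear ml).
  move=> u v /eqP; rewrite -[u]liftK -[v]liftK /= /m -!residueZ residue_eq.
  by rewrite -mulrBr => /areg uv; apply/eqP; rewrite residue_eq.
have [h hE] := Einj _ _ (to_linear ml) (to_linear fl) minj.
exists (h (residue _ 1)); split.
  move=> b bt; rewrite -linearZ -residueZ mulr1.
  have /eqP-> : residue (fun b => b \in t) b == 0.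
    by rewrite residue_eq0; apply: ideal_span_gen.
  by rewrite linear0.
by rewrite -linearZ; have /= := hE (residue _ 1); rewrite /m fE scale1r.
Qed.

(** The augmentation makes the Koszul complexes of M and of E quasi-isomorphic,
    and the latter is quasi-isomorphic to the annihilator of s in E because s is
    regular and the modules of E are injective. In other words, the Koszul
    cohomology of M is Ext(R/(s), M). *)
Lemma annihilated_cocycle_coboundary (s : seq R) (M : lmodType R)
    (E : injective_resolution M) k i (z : ires_obj E i) :
  regular_sequence s -> koszul_depth_ge s k M -> (i < k)%N ->
  (forall a, a \in s -> a *: z = 0) -> ires_diff E i z = 0 ->
  coboundary (z : obj (annihilator s (resolution E)) i).
Proof.
move=> sreg sdepth ik sz dz.
suff ac : acyclic (annihilator s (resolution E)) i by apply: ac; split.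
apply: (@annihilator_acyclic _ s [::]) => [t1 a t2 st j u [_ t1u]|].
  have Ej := @ires_injective _ _ E j.
  have [w [t1w aw]] := injective_module_divisible Ej (sreg _ _ _ st) t1u.
  by exists w.
have qi : quasi_iso (fun j (u : obj (annihilator [::] (resolution E)) j) =>
    (u : obj (resolution E) j)).
  split=> [|j]; first by split.
  split=> u [Cu du]; last first.
    by exists u; rewrite subrr; split=> //; apply: coboundary0.
  by case: j u Cu du => //= j u Cu du [w [_ ->]]; exists w.
apply/(koszul_acyclic_quasi_iso s i qi).
apply/(koszul_acyclic_quasi_iso s i (augmentation_quasi_iso E)).
exact: sdepth.
Qed.

End LocalCohomologyVanishing.

(** * Powers of the variables of a polynomial ring *)

Section PolynomialRing.
Local Open Scope ring_scope.
Variables (K : fieldType) (N : nat).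
Local Notation S := {mpoly K[N]}.

Definition variable_powers (r : nat) : seq S :=
  [seq 'X_i ^+ r | i <- enum 'I_N].

Lemma mem_variable_powers i r : 'X_i ^+ r \in variable_powers r.
Proof. by apply/mapP; exists i => //; rewrite mem_enum. Qed.

(** The ideal is spanned by monomials, so membership is read off the support. *)
Lemma ideal_span_variable_powers r (e : seq 'I_N) (p : S) :
  p \in ideal_span (fun b => b \in [seq 'X_i ^+ r | i <- e]) <->
  forall m, m \in msupp p -> exists2 i, i \in e & (r <= m i)%N.
Proof.
split=> [|pm].
  move: p; apply: ideal_span_ind.
  - by move=> m; rewrite msupp0.
  - by move=> p q Pp Pq m /msuppD_le; rewrite mem_cat => /orP[/Pp|/Pq].
  - move=> c _ /mapP[i ie ->] m; rewrite mpolyXn (perm_mem (msuppMX _ _)).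
    case/mapP=> m' _ ->; exists i => //.
    by rewrite mnmDE mulmnE mnm1E eqxx mul1n leq_addr.
rewrite [p]mpolyE big_seq.
elim/big_ind: _ => [||m /pm[i ie ri]]; [exact: ideal_span0|exact: ideal_spanD|].
rewrite -mul_mpolyC; apply: ideal_spanM.
have /submK <- : (U_(i) *+ r <= m)%MM.
  by apply/mnm_lepP=> j; rewrite mulmnE mnm1E; case: eqP => [<-|]; rewrite ?mul1n.
rewrite mpolyXD -mpolyXn; apply/ideal_spanM/ideal_span_gen.
by apply/mapP; exists i.
Qed.

Lemma variable_powers_regular r : regular_sequence (variable_powers r).
Proof.
move=> t1 a t2 st p.
pose e1 := take (size t1) (enum 'I_N).
have [i [e2 eE] aE] : exists2 i,
    exists e2, enum 'I_N = e1 ++ i :: e2 & a = 'X_i ^+ r.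
  have lt : (size t1 < size (enum 'I_N))%N.
    rewrite -(size_map (fun i => 'X_i ^+ r : S)) -/(variable_powers r) st.
    by rewrite size_cat /= addnS ltnS leq_addr.
  have := lt; case eE: (enum 'I_N) => [//|i0 e]; rewrite -eE => _.
  exists (nth i0 (enum 'I_N) (size t1)).
    by exists (drop (size t1).+1 (enum 'I_N)); rewrite -drop_nth // cat_take_drop.
  rewrite -(nth_map i0 0 (fun i => 'X_i ^+ r : S)) // -/(variable_powers r) st.
  by rewrite nth_cat ltnn subnn.
have t1E : t1 = [seq 'X_i ^+ r | i <- e1].
  by rewrite map_take -/(variable_powers r) st take_size_cat.
have ie1 : i \notin e1.
  by have := enum_uniq 'I_N; rewrite eE cat_uniq /= negb_or;
     case/and3P=> _ /andP[].
rewrite t1E aE => /ideal_span_variable_powers apE.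
apply/ideal_span_variable_powers=> m mp.
have [|j je1 jr] := apE (U_(i) *+ r + m)%MM.
  by rewrite mulrC mpolyXn (perm_mem (msuppMX _ _)); apply: map_f.
exists j => //; move: jr; rewrite mnmDE mulmnE mnm1E; case: eqP => // e.
by rewrite e je1 in ie1.
Qed.

Definition irrelevant_ideal : pred S :=
  ideal_span (fun p : S => exists i : 'I_N, p = 'X_i).

Lemma variable_power_mem i r :
  'X_i ^+ r \in ideal_pow irrelevant_ideal r.
Proof.
apply: ideal_span_gen; exists (fun=> 'X_i); split; last first.
  by rewrite prodr_const card_ord.
by move=> _; apply: ideal_span_gen; exists i.
Qed.

(** Pigeonhole principle: each factor is a combination of variables, and every
    variable it contributes lowers one of the exponents that annihilate w. *)
Lemma annihilated_product (M : lmodType S) k (r : 'I_N -> nat) (w : M)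
    (g : 'I_k -> S) :
  (\sum_i r i < k)%N -> (forall i, 'X_i ^+ r i *: w = 0) ->
  (forall j, g j \in irrelevant_ideal) -> (\prod_(j < k) g j) *: w = 0.
Proof.
elim: k r w g => [|k IHk] r w g // lt rw gI.
rewrite big_ord_recr /= -scalerA; set q := \prod_(_ < _) _.
have := gI ord_max; move: (g ord_max); apply: ideal_span_ind.
- by rewrite scale0r scaler0.
- by move=> a b aw bw; rewrite scalerDl scalerDr aw bw addr0.
move=> c _ [i ->]; rewrite scalerA mulrCA -!scalerA.
have [r0|r_gt0] := posnP (r i).
  by have := rw i; rewrite r0 expr0 scale1r => ->; rewrite !scaler0.
rewrite [X in c *: X](IHk (fun j => r j - (j == i))%N) ?scaler0 //.
  move: lt; rewrite !(bigD1 (P := xpredT) i) //= eqxx.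
  have -> : (\sum_(j < N | j != i) (r j - (j == i)) = \sum_(j < N | j != i) r j)%N.
    by apply: eq_bigr => j /negPf->; rewrite subn0.
  by rewrite -{1}(prednK r_gt0) addSn ltnS subn1.
move=> j; case: eqP => [->|_].
  by rewrite scalerA mulrC -exprS subn1 prednK // rw.
by rewrite subn0 scalerA mulrC -scalerA rw scaler0.
Qed.

Lemma annihilated_torsion (M : lmodType S) r (w : M) :
  (forall i, 'X_i ^+ r *: w = 0) -> torsion irrelevant_ideal w.
Proof.
move=> rw; exists (\sum_(i < N) r).+1; apply: ideal_span_ind.
- by rewrite scale0r.
- by move=> a b aw bw; rewrite scalerDl aw bw addr0.
- move=> c _ [g [gI ->]]; rewrite -scalerA (@annihilated_product _ _ (fun=> r)) //.
  by rewrite scaler0.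
Qed.

(** An element is torsion if and only if some power X_i^r of every variable
    annihilates it. A torsion cocycle is thus annihilated by the regular
    sequence of the X_i^r for one r, and so bounds an element with the same
    property. *)
Lemma depth_ge_local_cohomology k (A : S -> Prop) d :
  (forall r, depth_ge (variable_powers r) k A) ->
  local_cohomology_neq0 irrelevant_ideal (ideal_quotient A) d -> (k <= d)%N.
Proof.
move=> kA [E [z [[[r rz] dz] nz]]]; rewrite leqNgt; apply/negP => dk; apply: nz.
have /= := annihilated_cocycle_coboundary (@variable_powers_regular r)
  (kA r) dk _ dz.
case: d z rz dz dk => [|d] z rz dz dk /= bz.
  apply: bz => _ /mapP[i _ ->]; exact/rz/variable_power_mem.
have [|w [[_ sw] zE]] := bz.
  by move=> _ /mapP[i _ ->]; apply/rz/variable_power_mem.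
exists w; split=> //; apply: (annihilated_torsion (r := r)) => i.
exact/sw/mem_variable_powers.
Qed.

End PolynomialRing.

(** * Setting variables to zero *)

Section Kill.
Local Open Scope ring_scope.
Variables (K : fieldType) (N : nat) (W : pred 'I_N).
Local Notation S := {mpoly K[N]}.

Definition kill : {rmorphism S -> S} :=
  comp_mpoly [tuple (if W i then 0 else 'X_i : S) | i < N].

Lemma killX i : kill 'X_i = if W i then 0 else 'X_i.
Proof. by rewrite /= comp_mpolyXU -tnth_nth tnth_mktuple. Qed.

(** The polynomials p with this property form a subring that contains the
    constants and the variables. *)
Lemma sub_kill (A : S -> Prop) :
  (forall i, W i -> 'X_i \in ideal_span A) ->
  forall p, p - kill p \in ideal_span A.
Proof.
move=> WA.
have congM (p q : S) :
    p - kill p \in ideal_span A -> q - kill q \in ideal_span A ->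
    p * q - kill (p * q) \in ideal_span A.
  move=> Ap Aq; rewrite rmorphM.
  have -> : p * q - kill p * kill q = (p - kill p) * q + kill p * (q - kill q).
    by rewrite mulrBl mulrBr addrA subrK.
  by apply: ideal_spanD; [apply: ideal_spanMr|apply: ideal_spanM].
have powA k i : 'X_i ^+ k - kill ('X_i ^+ k) \in ideal_span A.
  elim: k => [|k IHk]; first by rewrite expr0 rmorph1 subrr ideal_span0.
  rewrite exprS; apply: (congM) => //; rewrite killX.
  by case: ifP => [/WA|_]; rewrite ?subr0 // subrr ideal_span0.
move=> p; rewrite [p]mpolyE; elim/big_ind: _ => [|q q' Aq Aq'|m _].
- by rewrite rmorph0 subrr ideal_span0.
- by rewrite rmorphD opprD addrACA; apply: ideal_spanD.
rewrite -mul_mpolyC; apply: (congM).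
  by rewrite /= comp_mpolyC subrr ideal_span0.
rewrite mpolyXE_id; apply: (big_ind (fun q => q - kill q \in ideal_span A)).
- by rewrite rmorph1 subrr ideal_span0.
- by move=> q q'; apply: (congM).
- by move=> i _; apply: powA.
Qed.

(** If p lies in (A), then p - kill p lies in (I): on a multiple of a generator
    g fixed by [kill], this difference is g times an element of the ideal of the
    killed variables. If p lies in (B), then kill p lies in (I). *)
Lemma kill_inter (A B I : S -> Prop) :
  (forall g, A g -> (g \in ideal_span I /\ kill g \in ideal_span I) \/
     (kill g = g /\ forall i, W i -> 'X_i * g \in ideal_span I)) ->
  (forall g, B g -> kill g \in ideal_span I) ->
  forall p, p \in ideal_span A -> p \in ideal_span B -> p \in ideal_span I.
Proof.
move=> AI BI p Ap /(ideal_span_morph BI) Ikp; rewrite -[p](subrK (kill p)).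
apply: ideal_spanD => //; move: p Ap {Ikp}; apply: ideal_span_ind.
- by rewrite rmorph0 subrr ideal_span0.
- by move=> p q Ip Iq; rewrite rmorphD opprD addrACA; apply: ideal_spanD.
move=> c g /AI[[Ig Ikg]|[kg WI]]; rewrite rmorphM.
  by apply: ideal_spanB; apply: ideal_spanM.
rewrite kg -mulrBl.
have : c - kill c \in ideal_span (fun q : S => exists2 i, W i & q = 'X_i).
  by apply: sub_kill => i Wi; apply: ideal_span_gen; exists i.
move: (_ - _); apply: ideal_span_ind; first by rewrite mul0r ideal_span0.
  by move=> q q' Iq Iq'; rewrite mulrDl; apply: ideal_spanD.
by move=> d _ [i Wi ->]; rewrite -mulrA; apply/ideal_spanM/WI.
Qed.

End Kill.


(** * Toric ideals are prime *)

Section Toric.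
Local Open Scope ring_scope.
Variables (K : fieldType) (N M : nat) (w : 'I_N -> 'X_{1..M}).
Local Notation S := {mpoly K[N]}.

Definition weight (m : 'X_{1..N}) : 'X_{1..M} := (\sum_i w i *+ m i)%MM.

Lemma weightD m1 m2 : weight (m1 + m2) = (weight m1 + weight m2)%MM.
Proof.
apply/mnmP => j; rewrite mnmDE !mnm_sumE -big_split /=; apply: eq_bigr => i _.
by rewrite !mulmnE mnmDE mulnDr.
Qed.

Lemma weight1 k : weight U_(k) = w k.
Proof.
rewrite /weight (bigD1 k) //= mnm1E eqxx mulm1n big1 ?addm0 // => i /negPf ik.
by rewrite mnm1E eq_sym ik mulm0n.
Qed.

Definition toric : {rmorphism S -> {mpoly K[M]}} :=
  comp_mpoly [tuple ('X_[w i] : {mpoly K[M]}) | i < N].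

Lemma toricX m : toric 'X_[m] = 'X_[weight m].
Proof.
rewrite /= comp_mpolyX /weight; apply/esym.
elim/big_ind2: _ => [|m1 p1 m2 p2 <- <-|i _]; rewrite ?mpolyX0 ?mpolyXD //.
by rewrite tnth_mktuple mpolyXn.
Qed.

Lemma mcoeff_toric p k :
  (toric p)@_k = \sum_(m <- msupp p) p@_m * (weight m == k)%:R.
Proof.
rewrite /= comp_mpolyEX raddf_sum /=; apply: eq_bigr => m _.
by rewrite -/(toric 'X_[m]) mcoeffZ toricX mcoeffX.
Qed.

(** The morphism identifies the monomials of equal weight and nothing else. If p
    is in its kernel and m in the support of p, then another monomial m' of the
    support has the weight of m, and subtracting a multiple of X^m - X^m'
    removes m from the support. *)
Lemma toric_ker (A : S -> Prop) p :
  (forall m m', weight m = weight m' -> 'X_[m] - 'X_[m'] \in ideal_span A) ->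
  toric p = 0 -> p \in ideal_span A.
Proof.
move=> Aw; have [k] := ubnP (size (msupp p)); elim: k p => // k IHk p lt tp.
have [->|p0] := eqVneq p 0; first exact: ideal_span0.
have mp := mlead_supp p0; move: (mlead p) mp => m mp.
have [m' [m'p m'm wm]] : exists m',
    [/\ m' \in msupp p, m' != m & weight m' = weight m].
  apply: contrapT => nex; have := mcoeff_toric p (weight m).
  rewrite tp mcoeff0 (bigD1_seq m) //= eqxx mulr1 big_seq_cond big1.
    by rewrite addr0 => /esym/eqP; move: mp; rewrite mcoeff_msupp => /negPf->.
  move=> m' /andP[m'p m'm]; case: eqP => [wm|_]; last by rewrite mulr0.
  by case: nex; exists m'.
pose q : S := p@_m *: ('X_[m] - 'X_[m']).
have Aq : q \in ideal_span A by rewrite /q -mul_mpolyC; apply/ideal_spanM/Aw.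
rewrite -[p](subrK q); apply: ideal_spanD => //; apply: IHk; last first.
  by rewrite rmorphB tp /q -mul_mpolyC rmorphM rmorphB !toricX wm subrr mulr0 subr0.
rewrite -ltnS; apply: leq_ltn_trans lt.
apply: (@uniq_leq_size _ (m :: msupp (p - q))).
  rewrite /= msupp_uniq andbT mcoeff_msupp mcoeffB mcoeffZ mcoeffB !mcoeffX.
  by rewrite eqxx (negPf m'm) subr0 mulr1 subrr eqxx.
move=> m1; rewrite inE => /predU1P[->//|/msuppB_le]; rewrite mem_cat.
case/orP=> // /msuppZ_le/msuppB_le; rewrite mem_cat !msuppX !inE.
by case/orP=> /eqP->.
Qed.

(** The ideal of A is the kernel of a morphism to an integral domain. *)
Lemma toric_regular (A : S -> Prop) q p :
  (forall g, A g -> toric g = 0) ->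
  (forall m m', weight m = weight m' -> 'X_[m] - 'X_[m'] \in ideal_span A) ->
  toric q != 0 -> q * p \in ideal_span A -> p \in ideal_span A.
Proof.
move=> A0 Aw q0 Aqp; apply: toric_ker => //.
have : toric (q * p) = 0.
  move: {p} (q * p) Aqp; apply: ideal_span_ind; first exact: rmorph0.
    by move=> a b a0 b0; rewrite rmorphD a0 b0 addr0.
  by move=> c g /A0 g0; rewrite rmorphM g0 mulr0.
by rewrite rmorphM => /eqP; rewrite mulf_eq0 (negPf q0) => /eqP.
Qed.

End Toric.

(** * Binomial ideals of disjoint cliques are toric *)

Section CliqueIdeal.
Local Open Scope ring_scope.
Variables (K : fieldType) (n : nat) (L : finType) (b : 'I_n -> L).
Local Notation S := {mpoly K[n + n]}.

Definition clique_binomial (p : S) : Prop :=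
  exists i j, b i = b j /\ p = edge_binomial K i j.

(** The monomial map x_i |-> z_i s_(b i), y_i |-> z_i: the columns (x_i, y_i)
    with label l become the multiples z_i (s_l, 1) of one column. *)
Definition clique_weight (k : 'I_(n + n)) : 'X_{1..n + #|L|} :=
  match split k with
  | inl i => (U_(lshift #|L| i) + U_(rshift n (enum_rank (b i))))%MM
  | inr i => U_(lshift #|L| i)%MM
  end.

Lemma clique_weight_x i :
  clique_weight (lshift n i) =
  (U_(lshift #|L| i) + U_(rshift n (enum_rank (b i))))%MM.
Proof. by rewrite /clique_weight -[lshift n i]/(unsplit (inl i)) unsplitK. Qed.

Lemma clique_weight_y i : clique_weight (rshift n i) = U_(lshift #|L| i)%MM.
Proof. by rewrite /clique_weight -[rshift n i]/(unsplit (inr i)) unsplitK. Qed.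

Local Notation wt := (weight clique_weight).

Lemma clique_weight_exchange i j : b i = b j ->
  wt (U_(lshift n i) + U_(rshift n j)) = wt (U_(lshift n j) + U_(rshift n i)).
Proof.
move=> bij; rewrite !weightD !weight1 !clique_weight_x !clique_weight_y bij.
by apply/mnmP=> k; rewrite !mnmDE addnC [X in (_ + X)%N]addnC addnA.
Qed.

Lemma weight_vertex m i :
  wt m (lshift #|L| i) = (m (lshift n i) + m (rshift n i))%N.
Proof.
rewrite /weight mnm_sumE big_split_ord /=; congr (_ + _)%N.
  rewrite (bigD1 i) //= big1 => [|j ji];
    rewrite clique_weight_x mulmnE mnmDE !mnm1E.
    by rewrite eqxx eq_rlshift mul1n addn0.
  by rewrite eq_lshift eq_rlshift (negPf ji).
rewrite (bigD1 i) //= big1 => [|j ji]; rewrite clique_weight_y mulmnE mnm1E.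
  by rewrite eqxx mul1n addn0.
by rewrite eq_lshift (negPf ji).
Qed.

Lemma weight_label m l :
  wt m (rshift n (enum_rank l)) = (\sum_(i | b i == l) m (lshift n i))%N.
Proof.
rewrite /weight mnm_sumE big_split_ord /=.
rewrite [X in (_ + X)%N]big1 => [|j _]; last first.
  by rewrite clique_weight_y mulmnE mnm1E eq_lrshift.
rewrite addn0 [RHS]big_mkcond; apply: eq_bigr => i _.
rewrite clique_weight_x mulmnE mnmDE !mnm1E eq_lrshift eq_rshift.
by rewrite (inj_eq enum_rank_inj); case: eqP; rewrite ?mul1n.
Qed.

Lemma weight_label_y m l :
  (\sum_(i | b i == l) wt m (lshift #|L| i) =
   wt m (rshift n (enum_rank l)) + \sum_(i | b i == l) m (rshift n i))%N.
Proof.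
by rewrite weight_label -big_split; apply: eq_bigr => i _; rewrite weight_vertex.
Qed.

Lemma clique_exchange (m : 'X_{1..n + n}) i j : b i = b j ->
  (0 < m (lshift n i))%N -> (0 < m (rshift n j))%N ->
  exists m', [/\ wt m' = wt m, 'X_[m] - 'X_[m'] \in ideal_span clique_binomial,
    (0 < m' (lshift n j))%N & (0 < m' (rshift n i))%N].
Proof.
move=> bij mi mj.
have le : (U_(lshift n i) + U_(rshift n j) <= m)%MM.
  apply/mnm_lepP=> k; rewrite mnmDE !mnm1E; case: eqP => [<-|_].
    by rewrite eq_rlshift addn0.
  by case: eqP => [<-|].
exists (m - (U_(lshift n i) + U_(rshift n j)) + (U_(lshift n j) + U_(rshift n i)))%MM.
split.
- by rewrite weightD -clique_weight_exchange // -weightD submK.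
- rewrite -{1}(submK le) !mpolyXD -mulrBr; apply/ideal_spanM/ideal_span_gen.
  by exists i, j.
- by rewrite !mnmDE !mnm1E eqxx addnCA.
- by rewrite !mnmDE !mnm1E eqxx addnA addnC.
Qed.

(** Monomials m and m' of equal weight that share a variable reduce to a smaller
    degree. If k divides m but not m', one exchange modulo a binomial makes k
    divide m': when k is x_i, comparing the exponents of z_i shows that y_i
    divides m', and comparing those of s_(b i) gives some x_j that divides m'
    with the same label; the roles of x and y are swapped when k is y_i. *)
Lemma clique_connected m m' : wt m = wt m' ->
  'X_[m] - 'X_[m'] \in ideal_span clique_binomial.
Proof.
have [d] := ubnP (mdeg m); elim: d m m' => // d IHd m m' lt w.
have shared k m1 : wt m = wt m1 -> (0 < m k)%N -> (0 < m1 k)%N ->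
    'X_[m] - 'X_[m1] \in ideal_span clique_binomial.
  move=> w1 mk m1k.
  have /submK e : (U_(k) <= m)%MM by rewrite lep1mP -lt0n.
  have /submK e1 : (U_(k) <= m1)%MM by rewrite lep1mP -lt0n.
  rewrite -e -e1 !mpolyXD -mulrBl; apply/ideal_spanMr/IHd.
    by move: lt; rewrite -{1}e mdegD mdeg1 addn1 ltnS.
  by move: w1; rewrite -{1}e -{1}e1 !weightD => /addIm.
have [m0|mn0] := eqVneq m 0%MM.
  suff -> : m' = 0%MM by rewrite m0 subrr ideal_span0.
  apply/mnmP=> k; rewrite mnm0E.
  have wz i : (m' (lshift n i) + m' (rshift n i) = 0)%N.
    by rewrite -weight_vertex -w weight_vertex m0 !mnm0E.
  by case: (splitP k) => i ki; have /eqP := wz i; rewrite addn_eq0 => /andP[];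
     [move=> /eqP <- _ | move=> _ /eqP <-]; congr (m' _); apply: val_inj.
have [k mk] : exists k, (0 < m k)%N.
  apply: contrapT => nex; case/eqP: mn0; apply/mnmP=> k; rewrite mnm0E.
  by apply/eqP; rewrite -leqn0 leqNgt; apply/negP => mk; apply: nex; exists k.
have [m'k|m'k] := posnP (m' k); last exact: (shared k).
have via m'' : wt m'' = wt m' ->
    'X_[m'] - 'X_[m''] \in ideal_span clique_binomial ->
    (0 < m'' k)%N -> 'X_[m] - 'X_[m'] \in ideal_span clique_binomial.
  move=> w'' m'm'' m''k.
  rewrite -['X_[m]](subrK 'X_[m'']) -addrA; apply: ideal_spanD.
    by apply: (shared k); rewrite ?w''.
  by rewrite -opprB ideal_spanN.
have wv i : (m (lshift n i) + m (rshift n i) =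
             m' (lshift n i) + m' (rshift n i))%N.
  by rewrite -!weight_vertex w.
case: (split_ordP k) mk m'k via => i -> mi m'i via {shared}.
  have yi : (0 < m' (rshift n i))%N.
    by have := wv i; rewrite m'i add0n => <-; rewrite addn_gt0 mi.
  have [j /eqP bj mj] : exists2 j, b j == b i & (0 < m' (lshift n j))%N.
    apply: contrapT => nex.
    have : (0 < wt m (rshift n (enum_rank (b i))))%N.
      by rewrite weight_label (bigD1 i) //= addn_gt0 mi.
    rewrite w weight_label lt0n sum_nat_eq0 => /negP; apply.
    apply/forallP=> j; apply/implyP=> bj; rewrite -leqn0 leqNgt.
    by apply/negP => mj; apply: nex; exists j.
  have [m'' [w'' m'm'' m''i _]] := clique_exchange bj mj yi.
  exact: via w'' m'm'' m''i.
have xi : (0 < m' (lshift n i))%N.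
  by have := wv i; rewrite m'i addn0 => <-; rewrite addn_gt0 mi orbT.
have [j bj mj] : exists2 j, b i = b j & (0 < m' (rshift n j))%N.
  apply: contrapT => nex.
  have eqy : (\sum_(j | b j == b i) m (rshift n j) =
              \sum_(j | b j == b i) m' (rshift n j))%N.
    by apply/(@addnI (wt m (rshift n (enum_rank (b i)))));
       rewrite -weight_label_y w weight_label_y.
  have : (0 < \sum_(j | b j == b i) m (rshift n j))%N.
    by rewrite (bigD1 i) //= addn_gt0 mi.
  rewrite eqy lt0n sum_nat_eq0 => /negP; apply.
  apply/forallP=> j; apply/implyP=> /eqP bj; rewrite -leqn0 leqNgt.
  by apply/negP => mj; apply: nex; exists j.
have [m'' [w'' m'm'' _ m''i]] := clique_exchange bj xi mj.
exact: via w'' m'm'' m''i.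
Qed.

Lemma clique_regular v (p : S) :
  xvar K v * p \in ideal_span clique_binomial ->
  p \in ideal_span clique_binomial.
Proof.
apply: (toric_regular (w := clique_weight)); last 1 first.
- by rewrite toricX -msupp_eq0 msuppX.
- move=> _ [i [j [bij ->]]]; rewrite /edge_binomial /xvar /yvar.
  rewrite rmorphB !rmorphM !toricX -!mpolyXD -!weightD.
  by rewrite clique_weight_exchange // subrr.
- exact: clique_connected.
Qed.

End CliqueIdeal.

(** * Depth for disjoint unions of complete graphs *)

Section VertexIdeal.
Local Open Scope ring_scope.
Variables (K : fieldType) (n : nat).
Local Notation S := {mpoly K[n + n]}.
Local Notation x := (@xvar K n).
Local Notation y := (@yvar K n).
Local Notation f := (@edge_binomial K n).
Implicit Types (X Y : {set 'I_n}) (e : 'I_n -> 'I_n -> Prop).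

(** In the recursions vertices get removed. Instead of changing the ring, the
    removed vertices stay with x_i, or both x_i and y_i, among the generators. *)
Definition vertex_ideal X Y e (p : S) : Prop :=
  [\/ exists2 i, i \in X & p = x i,
      exists2 i, i \in Y & p = y i
    | exists i j, [/\ i \notin X, j \notin X, e i j & p = f i j]].

Lemma edge_binomialC i j : f j i = - f i j.
Proof. by rewrite /edge_binomial opprB. Qed.

Lemma edge_binomialxx i : f i i = 0.
Proof. exact: subrr. Qed.

Lemma vertex_ideal_x X Y e i : i \in X -> x i \in ideal_span (vertex_ideal X Y e).
Proof. by move=> iX; apply: ideal_span_gen; constructor 1; exists i. Qed.

Lemma vertex_ideal_y X Y e i : i \in Y -> y i \in ideal_span (vertex_ideal X Y e).
Proof. by move=> iY; apply: ideal_span_gen; constructor 2; exists i. Qed.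

Lemma vertex_ideal_edge X Y e i j : i \notin X -> j \notin X -> e i j ->
  f i j \in ideal_span (vertex_ideal X Y e).
Proof. by move=> iX jX eij; apply: ideal_span_gen; constructor 3; exists i, j. Qed.

Lemma edge_binomial_in (A : S -> Prop) i j :
  x i \in ideal_span A -> x j \in ideal_span A -> f i j \in ideal_span A.
Proof. by move=> Ai Aj; apply: ideal_spanB; apply: ideal_spanMr. Qed.

Lemma edge_binomial_in_xy (A : S -> Prop) i j :
  x i \in ideal_span A -> y i \in ideal_span A -> f i j \in ideal_span A.
Proof.
by move=> Ax Ay; apply: ideal_spanB; [apply: ideal_spanMr|apply: ideal_spanM].
Qed.

Definition kill_xy X Y : {rmorphism S -> S} :=
  kill K (fun k => match split k with inl i => i \in X | inr i => i \in Y end).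

Lemma kill_x X Y i : kill_xy X Y (x i) = if i \in X then 0 else x i.
Proof. by rewrite killX -[lshift n i]/(unsplit (inl i)) unsplitK. Qed.

Lemma kill_y X Y i : kill_xy X Y (y i) = if i \in Y then 0 else y i.
Proof. by rewrite killX -[rshift n i]/(unsplit (inr i)) unsplitK. Qed.

Lemma kill_edge X Y i j : i \notin X -> i \notin Y -> j \notin X -> j \notin Y ->
  kill_xy X Y (f i j) = f i j.
Proof.
move=> /negPf iX /negPf iY /negPf jX /negPf jY.
by rewrite rmorphB !rmorphM !kill_x !kill_y iX iY jX jY.
Qed.

Lemma sub_kill_xy X Y (A : S -> Prop) :
  (forall i, i \in X -> x i \in ideal_span A) ->
  (forall i, i \in Y -> y i \in ideal_span A) ->
  forall p, p - kill_xy X Y p \in ideal_span A.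
Proof.
by move=> AX AY; apply: sub_kill => k; case: split_ordP => i -> => [/AX|/AY].
Qed.

Lemma kill_vertex_inter v (A B I : S -> Prop) :
  (forall g, A g ->
     (g \in ideal_span I /\ kill_xy [set v] [set v] g \in ideal_span I) \/
     [/\ kill_xy [set v] [set v] g = g, x v * g \in ideal_span I
        & y v * g \in ideal_span I]) ->
  (forall g, B g -> kill_xy [set v] [set v] g \in ideal_span I) ->
  forall p, p \in ideal_span A -> p \in ideal_span B -> p \in ideal_span I.
Proof.
move=> AI; apply: kill_inter => g /AI[|[kg xg yg]]; [by left|right].
by split=> // k; case: split_ordP => i -> /set1P->.
Qed.

(** After setting the killed variables to zero only clique binomials remain, and
    they generate a prime ideal without variables. The vertices of X are given
    labels of their own, so that no binomial involves them. *)
Lemma vertex_ideal_regular_x (L : finType) (b : 'I_n -> L) X Y v p :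
  Y \subset X -> v \notin X ->
  x v * p \in ideal_span (vertex_ideal X Y (fun i j => b i = b j)) ->
  p \in ideal_span (vertex_ideal X Y (fun i j => b i = b j)).
Proof.
move=> YX vX; set A := vertex_ideal _ _ _.
pose b' i : 'I_n + L := if i \in X then inl i else inr (b i).
have kA g : A g -> kill_xy X Y g \in ideal_span (@clique_binomial K n _ b').
  case=> [[i iX ->]|[i iY ->]|[i [j [iX jX bij ->]]]].
  - by rewrite kill_x iX ideal_span0.
  - by rewrite kill_y iY ideal_span0.
  - have nY k : k \notin X -> k \notin Y by apply/contra/(subsetP YX).
    rewrite kill_edge ?nY //; apply: ideal_span_gen; exists i, j; split=> //.
    by rewrite /b' (negPf iX) (negPf jX) bij.
move=> /(ideal_span_morph kA); rewrite rmorphM kill_x (negPf vX) => /clique_regular.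
have bA g : @clique_binomial K n _ b' g -> g \in ideal_span A.
  move=> [i [j [bij ->]]]; move: bij; rewrite /b'.
  case: ifP => iX; case: ifP => jX // [bij].
    by rewrite bij edge_binomialxx ideal_span0.
  by apply: vertex_ideal_edge; rewrite ?iX ?jX.
move=> /(ideal_span_sub bA) kp; rewrite -[p](subrK (kill_xy X Y p)).
apply: ideal_spanD => //; apply: sub_kill_xy => i iXY.
  exact: vertex_ideal_x.
exact: vertex_ideal_y.
Qed.

Lemma vertex_ideal_regular_y Y e v p : v \notin Y ->
  y v * p \in ideal_span (vertex_ideal setT Y e) ->
  p \in ideal_span (vertex_ideal setT Y e).
Proof.
move=> vY; set A := vertex_ideal _ _ _.
have k0 q : q \in ideal_span A -> kill_xy setT Y q = 0.
  move: q; apply: ideal_span_ind; first by rewrite rmorph0.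
    by move=> q q' q0 q'0; rewrite rmorphD q0 q'0 addr0.
  move=> c g Ag; rewrite rmorphM.
  case: Ag => [[i iX ->]|[i iY ->]|[i [j [iX jX bij ->]]]].
  - by rewrite kill_x iX mulr0.
  - by rewrite kill_y iY mulr0.
  - by rewrite inE in iX.
move=> /k0/eqP; rewrite rmorphM kill_y (negPf vY) mulf_eq0 => /orP[|/eqP kp].
  by rewrite -msupp_eq0 msuppX.
rewrite -[p]subr0 -kp; apply: sub_kill_xy => i iXY.
  exact: vertex_ideal_x.
exact: vertex_ideal_y.
Qed.

Variable r : nat.
Local Notation deep := (depth_ge (variable_powers K (n + n) r)).

Lemma deep_regular_var k (i : 'I_(n + n)) (A B : S -> Prop) :
  (forall p, 'X_i * p \in ideal_span A -> p \in ideal_span A) ->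
  (forall g, B g <-> A g \/ g = 'X_i) -> deep k B -> deep k.+1 A.
Proof. exact/depth_ge_regular/mem_variable_powers. Qed.

(** Modulo x_v the binomials of v become, up to sign, the products x_j y_v with
    j in the clique B of v. Hence the ideal splits: either all x_j with j in B
    vanish, or y_v vanishes and v leaves its clique. *)
Lemma clique_intersection (L : finType) (b : 'I_n -> L) X Y v p :
  let e i j := b i = b j in
  let B := [set i | i \notin X & b i == b v] in
  let I g := vertex_ideal X Y e g \/ g = x v in
  Y \subset X -> v \notin X ->
  (p \in ideal_span I <->
   p \in ideal_span (vertex_ideal (B :|: X) Y e) /\
   p \in ideal_span (vertex_ideal (v |: X) (v |: Y) e)).
Proof.
move=> e B I YX vX.
have Ix i : i \in v |: X -> x i \in ideal_span I.
  rewrite !inE => /predU1P[->|iX]; apply: ideal_span_gen; first by right.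
  by left; constructor 1; exists i.
have Iy i : i \in Y -> y i \in ideal_span I.
  by move=> iY; apply: ideal_span_gen; left; constructor 2; exists i.
have If i j : i \notin X -> j \notin X -> e i j -> f i j \in ideal_span I.
  by move=> iX jX eij; apply: ideal_span_gen; left; constructor 3; exists i, j.
have vB : v \in B by rewrite inE vX eqxx.
have vY : v \notin Y by apply: contra vX; apply/subsetP.
have inB i j : i \notin X -> j \notin X -> e i j -> (i \in B) = (j \in B).
  by move=> iX jX eij; rewrite !inE iX jX eij.
split=> [Ip|[Ap Bp]]; first split.
- move: p Ip; apply: ideal_span_sub.
  move=> g [[[i iX ->]|[i iY ->]|[i [j [iX jX eij ->]]]]|->].
  + by apply: vertex_ideal_x; rewrite inE iX orbT.
  + exact: vertex_ideal_y.
  + have [iB|iB] := boolP (i \in B).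
      apply: edge_binomial_in; apply: vertex_ideal_x; rewrite in_setU ?iB //.
      by rewrite -(inB i) ?iB.
    by apply: vertex_ideal_edge; rewrite ?in_setU ?negb_or ?iB -?(inB i) ?iB.
  + by apply: vertex_ideal_x; rewrite in_setU vB.
- move: p Ip; apply: ideal_span_sub.
  move=> g [[[i iX ->]|[i iY ->]|[i [j [iX jX eij ->]]]]|->].
  + by apply: vertex_ideal_x; rewrite inE iX orbT.
  + by apply: vertex_ideal_y; rewrite inE iY orbT.
  + have [->|iv] := eqVneq i v.
      by apply: edge_binomial_in_xy; [apply: vertex_ideal_x|apply: vertex_ideal_y];
         rewrite setU11.
    have [->|jv] := eqVneq j v.
      rewrite edge_binomialC; apply: ideal_spanN.
      by apply: edge_binomial_in_xy; [apply: vertex_ideal_x|apply: vertex_ideal_y];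
         rewrite setU11.
    by apply: vertex_ideal_edge; rewrite // in_setU1 negb_or ?iv ?jv.
  + by apply: vertex_ideal_x; rewrite setU11.
move: Ap Bp; apply: (kill_vertex_inter (v := v)).
- move=> g [[i iX ->]|[i iY ->]|[i [j [iX jX eij ->]]]].
  + have [iX'|iX'] := boolP (i \in v |: X).
      left; rewrite kill_x; split; first exact: Ix.
      by case: ifP; rewrite ?ideal_span0 ?Ix.
    have iv : i != v by move: iX'; rewrite !inE negb_or => /andP[].
    right; rewrite kill_x inE (negPf iv); split=> //.
      by apply: ideal_spanMr; apply: Ix; rewrite setU11.
    have iB : i \in B.
      move: iX iX'; rewrite !in_setU !inE negb_or => /orP[->//|->].
      by rewrite andbF.
    have : f i v \in ideal_span I.
      by move: iB; rewrite inE => /andP[iX'' /eqP biv]; apply: If.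
    move=> /(ideal_spanD (ideal_spanMr (y i) (Ix v (setU11 _ _)))).
    by rewrite /edge_binomial addrC subrK mulrC.
  + have iv : i != v by apply: contraNneq vY => <-.
    by left; rewrite kill_y inE (negPf iv); split; apply: Iy.
  + have nBX k : k \notin B :|: X -> k \notin X /\ k \notin [set v].
      rewrite in_setU negb_or => /andP[kB ->]; split=> //.
      by rewrite inE; apply: contraNneq kB => ->.
    have [[iX' iv] [jX' jv]] := (nBX _ iX, nBX _ jX).
    by left; rewrite kill_edge //; split; apply: If.
- move=> g [[i iX ->]|[i iY ->]|[i [j [iX jX eij ->]]]].
  + by rewrite kill_x; case: ifP; rewrite ?ideal_span0 ?Ix.
  + rewrite kill_y inE; move: iY; rewrite in_setU1.
    by case: eqP => //= _; rewrite ?ideal_span0 // => /Iy.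
  + move: iX jX; rewrite !in_setU1 !negb_or => /andP[iv iX] /andP[jv jX].
    by rewrite kill_edge ?inE //; apply: If.
Qed.

Lemma card_labels_collapse (L : finType) (b : 'I_n -> L) X X' v :
  v \notin X -> v \in X' -> X \subset X' ->
  (forall i, i \in X' -> i \notin X -> b i = b v) ->
  (forall i, i \notin X' -> b i != b v) ->
  #|b @: ~: X| = #|b @: ~: X'|.+1.
Proof.
move=> vX vX' XX' bv bnv; rewrite (cardsD1 (b v)).
have -> : b v \in b @: ~: X by apply: imset_f; rewrite inE.
rewrite add1n; congr _.+1; apply: eq_card => l; rewrite in_setD1.
apply/andP/imsetP => [[lv /imsetP[i iX li]]|[i iX' ->]].
  exists i => //; rewrite in_setC in iX; rewrite in_setC.
  by apply: contra lv => iX'; rewrite li bv.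
rewrite inE in iX'; split; first exact: bnv.
by apply: imset_f; rewrite inE; apply: contra iX'; apply/subsetP.
Qed.

(** Here #|b @: ~: X| is the number of cliques. If some vertex v is outside X,
    then x_v is regular, and the quotient by x_v is treated by
    [clique_intersection]: for both components the bound is one less, and for
    their sum, where B collapses and y_v vanishes, two less. If v is alone in
    its clique, killing x_v just removes the clique. When X is everything, the
    quotient is the polynomial ring in the y_i with i outside Y. *)
Lemma clique_depth (L : finType) (b : 'I_n -> L) X Y :
  Y \subset X ->
  deep (n - #|Y| + #|b @: ~: X|) (vertex_ideal X Y (fun i j => b i = b j)).
Proof.
set e := fun i j => _.
have [d] := ubnP (#|~: X| + #|~: Y|); elim: d X Y => // d IHd X Y lt YX.
have cardCU1 (Z : {set 'I_n}) v : v \notin Z -> #|~: Z| = #|~: (v |: Z)|.+1.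
  by move=> vZ; rewrite (cardsD1 v) inE vZ setCU setDE setIC.
have cardn (Z : {set 'I_n}) v : v \notin Z -> (n - #|Z| = (n - #|v |: Z|).+1)%N.
  have nE (T : {set 'I_n}) : (n - #|T| = #|~: T|)%N.
    by rewrite -[X in (X - _)%N](card_ord n) -(cardsC T) addKn.
  by rewrite !nE; apply: cardCU1.
have [X0|[v]] := set_0Vmem (~: X).
  have XT : X = setT by rewrite -[X]setCK X0 setC0.
  have [Y0|[v]] := set_0Vmem (~: Y).
    have -> : Y = setT by rewrite -[Y]setCK Y0 setC0.
    by rewrite cardsT card_ord subnn X0 imset0 cards0 => i.
  rewrite inE => vY; rewrite (cardn Y v) // addSn.
  apply: (@deep_regular_var _ (rshift n v) _ (vertex_ideal X (v |: Y) e)).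
  - by rewrite XT => p; apply: vertex_ideal_regular_y.
  - move=> g; split.
      case=> [gx|[i]|ge]; [by left; constructor 1| |by left; constructor 3].
      by rewrite in_setU1 => /predU1P[->|iY] ->; [right|left; constructor 2; exists i].
    case=> [[gx|[i iY ->]|ge]|->]; [by constructor 1| |by constructor 3|].
      by constructor 2; exists i; rewrite // in_setU1 iY orbT.
    by constructor 2; exists v; rewrite // setU11.
  - apply: IHd; last by rewrite XT subsetT.
    by move: lt; rewrite (cardCU1 Y v) // addnS ltnS.
rewrite inE => vX.
have vY : v \notin Y by apply: contra vX; apply/subsetP.
pose B := [set i | i \notin X & b i == b v].
have vB : v \in B by rewrite inE vX eqxx.
have cardB : #|b @: ~: X| = #|b @: ~: (B :|: X)|.+1.
  apply: (@card_labels_collapse _ _ _ _ v) => //; first by rewrite inE vB.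
  - exact: subsetUr.
  - by move=> i; rewrite in_setU => /orP[|->//]; rewrite inE => /andP[_ /eqP].
  - by move=> i; rewrite in_setU inE negb_or => /andP[/nandP[/negbNE->|//]].
have cardBX : (#|~: (B :|: X)| < #|~: X|)%N.
  apply/proper_card/properP; split; first by rewrite setCS subsetUr.
  by exists v; rewrite !inE ?vX ?eqxx.
rewrite cardB addnS.
pose I g := vertex_ideal X Y e g \/ g = x v.
apply: (@deep_regular_var _ (lshift n v) _ I) => //.
  by move=> p; apply: vertex_ideal_regular_x.
have dA : deep (n - #|Y| + #|b @: ~: (B :|: X)|) (vertex_ideal (B :|: X) Y e).
  apply: IHd; last exact: subset_trans YX (subsetUr _ _).
  by rewrite -ltnS; apply: leq_trans lt; rewrite !ltnS ltn_add2r.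
have IAB := fun p => clique_intersection b p YX vX.
have [B1|] := boolP (B \subset [set v]).
  move: dA; apply: depth_ge_eq => p; split=> [Ap|]; last by move/IAB=> [].
  move: p Ap; apply: ideal_span_sub => g [[i iX ->]|[i iY ->]|[i [j [iX jX eij ->]]]].
  - move: iX; rewrite in_setU => /orP[/(subsetP B1)/set1P->|iX].
      by apply: ideal_span_gen; right.
    by apply: ideal_span_gen; left; constructor 1; exists i.
  - by apply: ideal_span_gen; left; constructor 2; exists i.
  - move: iX jX; rewrite !in_setU !negb_or => /andP[_ iX] /andP[_ jX].
    by apply: ideal_span_gen; left; constructor 3; exists i, j.
case/subsetPn=> w wB wv.
have [wX /eqP bw] : w \notin X /\ b w == b v by move: wB; rewrite inE => /andP.
have cardv : #|b @: ~: (v |: X)| = #|b @: ~: X|.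
  apply/eqP; rewrite eqn_leq !subset_leq_card //.
    apply/subsetP=> _ /imsetP[i iX ->]; rewrite inE in iX.
    have [->|iv] := eqVneq i v.
      by rewrite -bw; apply: imset_f; rewrite !inE negb_or wX andbT -in_set1.
    by apply: imset_f; rewrite !inE negb_or iv.
  by apply: imsetS; rewrite setCS subsetUr.
apply: (depth_ge_inter (C := vertex_ideal (B :|: X) (v |: Y) e) IAB) dA _ _.
- apply: ideal_span_sub => g [[i iX ->]|[i iY ->]|[i [j [iX jX eij ->]]]].
  + exact: vertex_ideal_x.
  + by apply: vertex_ideal_y; rewrite in_setU1 iY orbT.
  + exact: vertex_ideal_edge.
- apply: ideal_span_sub => g [[i iX ->]|[i iY ->]|[i [j [iX jX eij ->]]]].
  + apply: vertex_ideal_x; move: iX; rewrite in_setU1 in_setU.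
    by case/predU1P=> [->|->]; rewrite ?vB ?orbT.
  + exact: vertex_ideal_y.
  + have XBX k : k \notin v |: X -> k \notin X by rewrite in_setU1 negb_or => /andP[].
    have [iB|iB] := boolP (i \in B).
      apply: edge_binomial_in; apply: vertex_ideal_x; rewrite in_setU ?iB //.
      by move: iB; rewrite !inE (XBX j) // -eij => /andP[_ ->].
    apply: vertex_ideal_edge; rewrite ?in_setU ?negb_or ?iB ?XBX //.
    by rewrite andbT; move: iB; rewrite !inE !XBX // -eij.
- move=> g [[i iX ->]|[i iY ->]|[i [j [iX jX eij ->]]]].
  + by left; apply: vertex_ideal_x.
  + by right; apply: vertex_ideal_y.
  + by left; apply: vertex_ideal_edge.
- have := IHd (v |: X) (v |: Y); rewrite cardv cardB (cardn Y v) // addnS addSn.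
  apply; last exact: setUS.
  by move: lt; rewrite (cardCU1 X v) // (cardCU1 Y v) // addSn addnS !ltnS => /ltnW.
- rewrite (cardn Y v) //; apply: IHd; last first.
    rewrite subUset sub1set in_setU vB /=; exact: subset_trans YX (subsetUr _ _).
  move: lt; rewrite (cardCU1 Y v) // addnS !ltnS; apply: leq_trans.
  by rewrite ltnS leq_add2r ltnW.
Qed.

End VertexIdeal.

(** * Binomial edge ideals and the recursion on graphs *)

Section GraphIdeal.
Local Open Scope ring_scope.
Variables (K : fieldType) (n : nat).
Local Notation S := {mpoly K[n + n]}.
Local Notation x := (@xvar K n).
Local Notation y := (@yvar K n).
Local Notation f := (@edge_binomial K n).

(** The binomial edge ideal of a graph with vertices embedded in 'I_n, together
    with the variables of the indices that are not vertices. This keeps a graph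
    and its vertex-deleted subgraphs in the same polynomial ring. *)
Definition graph_ideal (V : finType) (h : V -> 'I_n) (G : sgraph V) :
    S -> Prop :=
  vertex_ideal (~: (h @: setT)) (~: (h @: setT))
    (fun i j => exists u w, [/\ i = h u, j = h w & G u w]).

Section OneGraph.
Variables (V : finType) (h : V -> 'I_n) (G : sgraph V).

Lemma vertex_in_image u : h u \notin ~: (h @: setT).
Proof. by rewrite inE negbK; apply: imset_f. Qed.

Lemma graph_ideal_edge u w :
  G u w -> f (h u) (h w) \in ideal_span (graph_ideal h G).
Proof.
by move=> Guw; apply: vertex_ideal_edge; rewrite ?vertex_in_image //; exists u, w.
Qed.

Lemma graph_idealP (A : S -> Prop) :
  (forall i, i \notin h @: setT -> x i \in ideal_span A /\ y i \in ideal_span A) ->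
  (forall u w, G u w -> f (h u) (h w) \in ideal_span A) ->
  forall p, p \in ideal_span (graph_ideal h G) -> p \in ideal_span A.
Proof.
move=> AX AG; apply: ideal_span_sub => g [[i iX ->]|[i iY ->]|].
- by move: iX; rewrite inE => /AX[].
- by move: iY; rewrite inE => /AX[].
- by move=> [i [j [_ _ [u [w [-> -> Guw]]] ->]]]; apply: AG.
Qed.

Lemma graph_ideal_x i :
  i \notin h @: setT -> x i \in ideal_span (graph_ideal h G).
Proof. by move=> iX; apply: vertex_ideal_x; rewrite inE. Qed.

Lemma graph_ideal_y i :
  i \notin h @: setT -> y i \in ideal_span (graph_ideal h G).
Proof. by move=> iX; apply: vertex_ideal_y; rewrite inE. Qed.

End OneGraph.

Section Split.
Variables (V : finType) (h : V -> 'I_n) (G : sgraph V) (v : V).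
Hypothesis h_inj : injective h.

Let h' (u : {x : V | x != v}) := h (val u).

Lemma image_del i : (i \in h' @: setT) = (i != h v) && (i \in h @: setT).
Proof.
apply/imsetP/andP=> [[u _ ->]|[iv /imsetP[u _ iu]]].
  by rewrite (inj_eq h_inj); split; [apply: (valP u)|apply: imset_f].
by move: iv; rewrite iu (inj_eq h_inj) => uv; exists (Sub u uv).
Qed.

Lemma del_vertex_edge (H : sgraph V) u w : u != v -> w != v -> H u w ->
  f (h u) (h w) \in ideal_span (graph_ideal h' (del_vertex H v)).
Proof.
move=> uv wv Huw.
exact: (@graph_ideal_edge _ h' (del_vertex H v) (Sub u uv) (Sub w wv)).
Qed.

Lemma graph_ideal_sub_del (H : sgraph V) p :
  p \in ideal_span (graph_ideal h H) ->
  p \in ideal_span (graph_ideal h' (del_vertex H v)).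
Proof.
have xv : h v \notin h' @: setT by rewrite image_del eqxx.
move: p; apply: graph_idealP => [i iX|u w Huw].
  by split; [apply: graph_ideal_x|apply: graph_ideal_y];
     rewrite image_del (negPf iX) andbF.
have [->|uv] := eqVneq u v.
  by apply: edge_binomial_in_xy; [apply: graph_ideal_x|apply: graph_ideal_y].
have [->|wv] := eqVneq w v; last exact: del_vertex_edge.
rewrite edge_binomialC; apply: ideal_spanN.
by apply: edge_binomial_in_xy; [apply: graph_ideal_x|apply: graph_ideal_y].
Qed.

Lemma graph_ideal_sub_nbhd p :
  p \in ideal_span (graph_ideal h G) ->
  p \in ideal_span (graph_ideal h (complete_nbhd G v)).
Proof.
move: p; apply: graph_idealP => [i iX|u w Guw].
  by split; [apply: graph_ideal_x|apply: graph_ideal_y].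
by apply: graph_ideal_edge; rewrite /= /complete_nbhd_rel Guw.
Qed.

(** The two Plücker relations say that x_v and y_v multiply the new binomials of
    G_v into the ideal of G. *)
Lemma plucker_x i j k : x k * f i j = x i * f k j - x j * f k i.
Proof. rewrite /edge_binomial; ring. Qed.

Lemma plucker_y i j k : y k * f i j = y i * f k j - y j * f k i.
Proof. rewrite /edge_binomial; ring. Qed.

(** Setting x_v = y_v = 0 fixes the binomials of the edges added in G_v, which
    x_v and y_v multiply into J_G, and kills or fixes those of G; so
    [kill_vertex_inter] applies. *)
Lemma graph_ideal_inter p :
  p \in ideal_span (graph_ideal h G) <->
  p \in ideal_span (graph_ideal h (complete_nbhd G v)) /\
  p \in ideal_span (graph_ideal h' (del_vertex G v)).
Proof.
split=> [Ip|[]].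
  by split; [apply: graph_ideal_sub_nbhd|apply: graph_ideal_sub_del].
set I := graph_ideal h G.
have kx i : kill_xy K [set h v] [set h v] (x i) = if i == h v then 0 else x i.
  by rewrite kill_x inE.
have ky i : kill_xy K [set h v] [set h v] (y i) = if i == h v then 0 else y i.
  by rewrite kill_y inE.
have kf u w : u != v -> w != v ->
    kill_xy K [set h v] [set h v] (f (h u) (h w)) = f (h u) (h w).
  by move=> uv wv; rewrite kill_edge // inE (inj_eq h_inj).
have Ix i : i \notin h @: setT ->
    kill_xy K [set h v] [set h v] (x i) \in ideal_span I /\
    kill_xy K [set h v] [set h v] (y i) \in ideal_span I.
  move=> iX; rewrite kx ky; case: eqP => _; first by rewrite ideal_span0.
  by split; [apply: graph_ideal_x|apply: graph_ideal_y].
apply: (kill_vertex_inter (v := h v)).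
- move=> g [[i iX ->]|[i iY ->]|[i [j [_ _ [u [w [-> -> Guw]]] ->]]]].
  + rewrite inE in iX; left; split; first exact: graph_ideal_x.
    by case: (Ix i iX).
  + rewrite inE in iY; left; split; first exact: graph_ideal_y.
    by case: (Ix i iY).
  case/orP: Guw => [Guw|/and3P[uw Gvu Gvw]].
    left; split; first exact: graph_ideal_edge.
    have [->|uv] := eqVneq u v.
      by rewrite rmorphB !rmorphM !kx !ky eqxx mul0r mulr0 subr0 ideal_span0.
    have [->|wv] := eqVneq w v.
      by rewrite rmorphB !rmorphM !kx !ky eqxx mul0r mulr0 subr0 ideal_span0.
    by rewrite kf //; apply: graph_ideal_edge.
  have Gv k : G v k -> k != v by apply: contraTneq => ->; rewrite edge_irr.
  right; split; first by rewrite kf ?Gv.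
    rewrite plucker_x.
    by apply: ideal_spanB; apply: ideal_spanM; apply: graph_ideal_edge.
  rewrite plucker_y.
  by apply: ideal_spanB; apply: ideal_spanM; apply: graph_ideal_edge.
- have xyI i : i \notin h' @: setT ->
      kill_xy K [set h v] [set h v] (x i) \in ideal_span I /\
      kill_xy K [set h v] [set h v] (y i) \in ideal_span I.
    rewrite image_del negb_and negbK => /orP[/eqP->|/Ix//].
    by rewrite kx ky eqxx ideal_span0.
  move=> g [[i iX ->]|[i iY ->]|[i [j [_ _ [u [w [-> -> /= Guw]]] ->]]]].
  + by rewrite inE in iX; case: (xyI i iX).
  + by rewrite inE in iY; case: (xyI i iY).
  + by rewrite kf ?(valP u) ?(valP w) //; apply: graph_ideal_edge.
Qed.

End Split.

Variable r : nat.
Local Notation deep := (depth_ge (variable_powers K (n + n) r)).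

(** Vertices are labelled by their blocks. *)
Lemma clique_graph_depth (V : finType) (h : V -> 'I_n) (G : sgraph V)
    (P : {set {set V}}) :
  injective h -> disjoint_union_complete G P ->
  deep (#|P| + \sum_(B in P) #|B|) (graph_ideal h G).
Proof.
move=> h_inj [/and3P[/eqP covP triP P0] GP].
pose b i : {set V} := if [pick u | h u == i] is Some u then pblock P u else set0.
have bh u : b (h u) = pblock P u.
  rewrite /b; case: pickP => [u' /eqP/h_inj->//|/(_ u)]; by rewrite eqxx.
have cov u : u \in cover P by rewrite covP inE.
have := @clique_depth K n r _ b _ _ (subxx (~: (h @: setT))).
rewrite setCK (_ : n - _ = #|V|)%N; last first.
  rewrite -[X in (X - _)%N](card_ord n) -(cardsC (h @: setT)) addnK.
  by rewrite card_imset // cardsT.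
have -> : b @: (h @: setT) = P.
  apply/setP=> B; apply/imsetP/idP => [[_ /imsetP[u _ ->] ->]|BP].
    by rewrite bh pblock_mem.
  have [B0|[u uB]] := set_0Vmem B; first by move: P0; rewrite -B0 BP.
  by exists (h u); rewrite ?imset_f // bh (def_pblock triP BP uB).
have -> : (\sum_(B in P) #|B| = #|V|)%N.
  by rewrite (eqP triP) covP cardsT.
rewrite addnC; apply: depth_ge_eq => p; split; last first.
  move: p; apply: graph_idealP => [i iX|u w Guw].
    by split; [apply: vertex_ideal_x|apply: vertex_ideal_y]; rewrite inE.
  apply: vertex_ideal_edge; rewrite ?vertex_in_image // !bh.
  have [_ [B BP /andP[uB wB]]] := (GP u w).1 Guw.
  by rewrite (def_pblock triP BP uB) (def_pblock triP BP wB).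
move: p; apply: ideal_span_sub => g [[i iX ->]|[i iY ->]|[i [j [iX jX bij ->]]]].
- by rewrite inE in iX; apply: graph_ideal_x.
- by rewrite inE in iY; apply: graph_ideal_y.
move: iX jX bij; rewrite !inE !negbK => /imsetP[u _ ->] /imsetP[w _ ->].
rewrite !bh => uw; have [->|neq] := eqVneq u w.
  by rewrite edge_binomialxx ideal_span0.
apply: graph_ideal_edge; apply/GP; split=> //.
exists (pblock P u); first by rewrite pblock_mem.
by rewrite {2}uw !mem_pblock !cov.
Qed.

(** The measure of the recursion. The diagonal pairs are counted, so that it
    drops when a vertex is removed. *)
Definition non_adjacent (V : finType) (G : sgraph V) : {set V * V} :=
  [set p | ~~ G p.1 p.2].

Lemma card_non_adjacent_nbhd (V : finType) (G : sgraph V) v :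
  ~ free_vertex G v ->
  (#|non_adjacent (complete_nbhd G v)| < #|non_adjacent G|)%N.
Proof.
move=> nfree; apply/proper_card/properP; split.
  apply/subsetP=> -[u w]; rewrite !inE /= /complete_nbhd_rel negb_or.
  by case/andP.
apply: contrapT => nex; apply: nfree => u w Gvu Gvw uw.
apply: contrapT => /negP nuw; apply: nex; exists (u, w); rewrite inE //=.
by rewrite /complete_nbhd_rel negbK uw Gvu Gvw orbT.
Qed.

Lemma card_non_adjacent_del (V : finType) (G : sgraph V) v :
  (#|non_adjacent (del_vertex G v)| < #|non_adjacent G|)%N.
Proof.
pose g (p : {x : V | x != v} * {x : V | x != v}) := (val p.1, val p.2).
have g_inj : injective g by move=> [a b] [c d] [/val_inj-> /val_inj->].
rewrite -(card_imset _ g_inj); apply/proper_card/properP; split.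
  by apply/subsetP=> _ /imsetP[p pn ->]; move: pn; rewrite !inE.
exists (v, v); first by rewrite inE edge_irr.
by apply/imsetP=> -[[a c] _ [va _]]; case/eqP: (valP a); apply: esym va.
Qed.

(** The three inequalities of d-compatibility are those that the depth lemma
    asks for in the sequence
    0 -> S/J_G -> S/J_(G_v) x S/((x_v,y_v)+J_(G-v)) -> S/((x_v,y_v)+J_(G_v-v)) -> 0. *)
Lemma graph_depth (psi : forall V : finType, sgraph V -> nat)
    (V : finType) (h : V -> 'I_n) (G : sgraph V) :
  d_compatible psi -> injective h -> deep (psi V G) (graph_ideal h G).
Proof.
move=> [psi_clique psi_step].
have [d] := ubnP #|non_adjacent G|; elim: d V h G => // d IHd V h G lt h_inj.
have [[P GP]|nGP] :=
  pselect (exists P : {set {set V}}, disjoint_union_complete G P).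
  exact: depth_ge_leq (psi_clique V G P GP) (clique_graph_depth h_inj GP).
have [v [nfree p1 p2 p3]] := psi_step V G nGP.
have lt' (V' : finType) (H : sgraph V') :
    (#|non_adjacent H| < #|non_adjacent G|)%N -> (#|non_adjacent H| < d)%N.
  by move=> ltH; apply: leq_trans ltH _; rewrite -ltnS.
have ltn := card_non_adjacent_nbhd nfree.
have h'_inj : injective (fun u : {x : V | x != v} => h (val u)).
  by move=> u w /h_inj/val_inj.
apply: (depth_ge_inter (graph_ideal_inter G v h_inj)
  (C := graph_ideal (fun u : {x : V | x != v} => h (val u))
          (del_vertex (complete_nbhd G v) v))).
- by move=> p; apply: graph_ideal_sub_del.
- move=> p; apply: graph_idealP => [i iX|u w Guw].
    by split; [apply: graph_ideal_x|apply: graph_ideal_y].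
  apply: (@graph_ideal_edge _ (fun u : {x : V | x != v} => h (val u))
    (del_vertex (complete_nbhd G v) v)).
  by rewrite /= /complete_nbhd_rel; move: Guw => /= ->.
- move=> g [[i iX ->]|[i iY ->]|[i [j [_ _ [u [w [-> -> /= Guw]]] ->]]]].
  + by right; apply: vertex_ideal_x.
  + by right; apply: vertex_ideal_y.
  + by left; apply: graph_ideal_edge.
- exact: depth_ge_leq p2 (IHd _ _ _ (lt' _ _ ltn) h_inj).
- exact: depth_ge_leq p1 (IHd _ _ _ (lt' _ _ (card_non_adjacent_del G v)) h'_inj).
- rewrite -subn1; apply: depth_ge_leq p3 (IHd _ _ _ (lt' _ _ _) h'_inj).
  exact: ltn_trans (card_non_adjacent_del _ v) ltn.
Qed.

Lemma binomial_edge_idealE (G : sgraph 'I_n) p :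
  p \in ideal_span (graph_ideal id G) <-> p \in @binomial_edge_ideal K n G.
Proof.
split; move: p.
  apply: graph_idealP => [i|i j Gij]; first by rewrite imset_id inE.
  have [lt|gt|e] := ltngtP i j.
  - by apply: ideal_span_gen; exists i, j.
  - rewrite edge_binomialC; apply/ideal_spanN/ideal_span_gen.
    by exists j, i; rewrite edge_sym.
  - by rewrite (val_inj e) edge_irr in Gij.
by apply: ideal_span_sub => _ [i [j [_ Gij ->]]]; apply: (@graph_ideal_edge _ id).
Qed.

End GraphIdeal.

Theorem theorem3p3 (K : fieldType) (n : nat) (G : sgraph 'I_n)
  (psi : forall V : finType, sgraph V -> nat) (hpsi : d_compatible psi) :
  forall d : nat,
    is_depth (@max_homogeneous_ideal K n) (binomial_edge_quotient K G) d ->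
    psi _ G <= d.
Proof.
move=> d [d_neq0 _]; apply: (depth_ge_local_cohomology _ d_neq0) => r.
apply: depth_ge_eq (@graph_depth K n r psi _ id G hpsi (@inj_id _)) => p.
exact: binomial_edge_idealE.
Qed.
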